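(* Let $n\ge2$, $w\in\mathfrak{S}_n$ and $i\in\{1,\dots,n-1\}$. Then the summand $I_{\gamma_w}^{i/n}$ of the permuton ideal $I_{\gamma_w}$ coincides with the picture of the radical filtration of the summand $I_w^i$ of the permutation ideal $I_w$; that is, the subset $$\{(x,t)\in(0,1)\times\mathbb{R} : \text{there is a path like morphism of length } t \text{ in } I_{\gamma_w}^{i/n}(x)\}$$ is equal to the union, over all composition factors of $I_w^i$, of the half-open squares representing them in the picture of the radical filtration of $I_w^i$.
   Context: Discrete side. Let $\Bbbk$ be an algebraically closed field and $\Lambda_n$ the preprojective algebra of type $A_{n-1}$: the path algebra of the quiver with vertices $1,\dots,n-1$ and arrows $\alpha_j:j\to j+1$, $\alpha_j^*:j+1\to j$ for $1\le j\le n-2$, modulo the relations $\alpha_j^*\alpha_j=\alpha_{j-1}\alpha_{j-1}^*$ for all $1\le j\le n-1$ (with $\alpha_j=\alpha_j^*=0$ for $j\notin\{1,\dots,n-2\}$). For each $i,j$, $e_i\Lambda_ne_j$ has a basis of nonzero paths, at most one of each length (number of arrows). $\mathfrak{S}_n$ is the symmetric group on $\{1,\dots,n\}$, with product composition of functions, $s_j=(j\ j+1)$. $I_j$ is the kernel of a nonzero map $\Lambda_n\to S_j$ ($S_j$ the simple module at $j$), i.e. the two-sided ideal spanned by all nonzero paths other than $e_j$. For $w=s_{i_1}\cdots s_{i_r}$ a reduced expression, the permutation ideal is $I_w=I_{i_1}\cdots I_{i_r}$ (independent of the reduced expression; $I_{\mathrm{id}}=\Lambda_n$). $P_i=e_i\Lambda_n$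 is the indecomposable projective right module at $i$ and $I_w^i=e_iI_w$ is the summand of $I_w$ contained in $P_i$. The composition factors of $I_w^i$ correspond to the nonzero paths lying in $e_iI_we_j$, $1\le j\le n-1$: a nonzero path of length $\ell$ in $e_iI_we_j$ gives a factor $S_j$. Picture. The plane has horizontal coordinate $x$ and vertical coordinate $t$ increasing downwards. In the picture of the radical filtration, the composition factor $S_j$ given by a path of length $\ell$ is drawn as the square (rotated by 45 degrees, lower boundary removed) $$\{(x,t): \tfrac{\ell}{n}+|x-\tfrac jn|\le t<\tfrac{\ell+2}{n}-|x-\tfrac jn|\},$$ so that squares for $S_j$ are centred at $x=j/n$, and the rectangle of $P_i$ has its top vertex at $t=0$ and bottom vertex at $t=1$. Continuous side. $\Lambda_{\mathbb{R}}$ is the $\Bbbk$-linear category with objects the real numbers (plus a zero object) generated by morphisms $\alpha_{yx}:x\to y$ and $\alpha^*_{xy}:y\to x$ for $x<y$, with $\alpha_{xx}=\alpha^*_{xx}=1_x$, subject to: (1) $\alpha_{zy}\alpha_{yx}=\alpha_{zx}$ and $\alpha^*_{xy}\alpha^*_{yz}=\alpha^*_{xz}$ for $x\le y\le z$; (2) $\alpha^*_{x+a-b,x+a}\alpha_{x+a,x}=\alpha_{x+a-b,x-b}\alpha^*_{x-b,x}$ for $a,b>0$. $\Lambda=\Lambda_{(0,1)}$ is its quotient category obtained by setting every object $x\notin(0,1)$ isomorphic to zero. A morphism of $\Lambda$ is path like if it is a nonzero composition of $\alpha$'s and $\alpha^*$'s; the length of $\alpha_{yx}$ and of $\alpha^*_{xy}$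 is $|x-y|$, and lengths add under composition. For $y\in(0,1)$ and a permuton $\mu$ (a Borel measure on $[0,1]^2$ with $\mu([0,k]\times[0,1])=k=\mu([0,1]\times[0,k])$ for all $k$), put $f_{\mu,y}(x)=-2\mu([0,x]\times[0,y])+y+x$. The summand $I_\mu^y$ of the permuton ideal $I_\mu=\bigoplus_{y\in(0,1)}I_\mu^y$ is the submodule of $\operatorname{Hom}_\Lambda(y,-)$ with $I_\mu^y(x)$ spanned by the path like morphisms $y\to x$ of length at least $f_{\mu,y}(x)$. For $w\in\mathfrak{S}_n$ the permuton $\gamma_w$ is obtained by dividing the unit square into $n$ equal columns and $n$ equal rows and putting a uniform measure of total weight $1/n$ on each of the squares $[\frac{j-1}n,\frac jn]\times[\frac{w(j)-1}n,\frac{w(j)}n]$, $1\le j\le n$. *)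

(* Defs.v *)
From HB Require Import structures.
From mathcomp Require Import all_boot all_order all_algebra all_fingroup.
From mathcomp Require Import -(notations) monalg.
From mathcomp Require Import all_classical all_reals all_analysis.
From mathcomp Require Import finmap generic_quotient ring_quotient.

Set Implicit Arguments.
Unset Strict Implicit.
Unset Printing Implicit Defensive.

Import Order.TTheory GRing.Theory Num.Theory.
Import numFieldNormedType.Exports.

Local Open Scope classical_set_scope.
Local Open Scope ring_scope.
Local Open Scope quotient_scope.

Section Span.
Variables (k : fieldType) (E : lmodType k).

Definition subspace (S : set E) : Prop :=
  S 0 /\ forall (c : k) (u v : E), S u -> S v -> S (c *: u + v).

Definition span (S : set E) : set E := smallest subspace S.

Lemma subspace_span (S : set E) : subspace (span S).
Proof.
split=> [|c u v Su Sv] A [[A0 AZ] SA] //.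
by apply: (AZ); [apply: Su | apply: Sv].
Qed.

End Span.

Section QuiverAlgebra.
Variables (k : fieldType) (V : choiceType) (e : rel V).

(* The quiver with vertex set V and exactly one arrow x -> y whenever e x y.
   A path is recorded as its starting vertex followed by the list of the
   vertices it visits; the trivial paths are the (x, [::]). *)
Definition qpath : Type := {p : V * seq V | path e p.1 p.2}.
HB.instance Definition _ := Choice.on qpath.
HB.instance Definition _ := SubType.on qpath.

Definition source (p : qpath) : V := (val p).1.
Definition target (p : qpath) : V := last (val p).1 (val p).2.

Definition pathalg : Type := malg qpath k.
HB.instance Definition _ := GRing.Lmodule.on pathalg.

Definition elt (p : option qpath) : pathalg :=
  if p is Some p then mkmalgU p 1 else 0.

Definition idem (x : V) : pathalg := elt (insub (x, [::])).

(* Zero when there is no arrow x -> y. *)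
Definition arrow (x y : V) : pathalg := elt (insub (x, [:: y])).

(* Paths compose like functions: "p after q". *)
Definition pcomp (p q : qpath) : option qpath :=
  if target q == source p
  then insub ((val q).1, (val q).2 ++ (val p).2) else None.

Lemma pcomp_some (p q : qpath) : target q = source p ->
  exists2 r, pcomp p q = Some r & val r = ((val q).1, (val q).2 ++ (val p).2).
Proof.
move=> E; rewrite /pcomp E eqxx; case: insubP => [r _ rE|]; first by exists r.
move: E; rewrite /target /source /= cat_path => ->.
by rewrite (valP p) (valP q).
Qed.

Definition pmul (a b : pathalg) : pathalg :=
  \sum_(p <- msupp a) \sum_(q <- msupp b)
    (mcoeff p a * mcoeff q b) *: elt (pcomp p q).

Definition two_sided_ideal (S : set pathalg) : Prop :=
  subspace S /\
  (forall a b : pathalg, S b -> S (pmul a b) /\ S (pmul b a)).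

Definition gen_ideal (rels : set pathalg) : set pathalg :=
  smallest two_sided_ideal rels.

Lemma pmulEw (d1 d2 : {fset qpath}) (a b : pathalg) :
  fsubset (msupp a) d1 -> fsubset (msupp b) d2 ->
  pmul a b = \sum_(p <- d1) \sum_(q <- d2)
    (mcoeff p a * mcoeff q b) *: elt (pcomp p q).
Proof.
move=> s1 s2; rewrite /pmul (big_fset_incl _ s1) /=.
  apply: eq_bigr => p _; apply: big_fset_incl => // q _ /mcoeff_outdom ->.
  by rewrite mulr0 scale0r.
move=> p _ /mcoeff_outdom ap; rewrite big1 // => q _.
by rewrite ap mul0r scale0r.
Qed.

Lemma pmulDl (c : k) (a a' b : pathalg) :
  pmul (c *: a + a') b = c *: pmul a b + pmul a' b.
Proof.
pose d := fsetU (msupp a) (fsetU (msupp a') (msupp (c *: a + a'))).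
have sa : fsubset (msupp a) d by rewrite fsubsetUl.
have sa' : fsubset (msupp a') d.
  by rewrite /d fsetUCA fsubsetUl.
have saa : fsubset (msupp (c *: a + a')) d.
  by rewrite /d fsetUA fsubsetUr.
have sb : fsubset (msupp b) (msupp b) by exact: fsubset_refl.
rewrite (pmulEw sa sb) (pmulEw sa' sb) (pmulEw saa sb).
rewrite scaler_sumr -big_split; apply: eq_bigr => p _ /=.
rewrite scaler_sumr -big_split; apply: eq_bigr => q _ /=.
by rewrite mcoeffD mcoeffZ mulrDl scalerDl scalerA mulrA.
Qed.

Lemma pmulDr (c : k) (a b b' : pathalg) :
  pmul a (c *: b + b') = c *: pmul a b + pmul a b'.
Proof.
pose d := fsetU (msupp b) (fsetU (msupp b') (msupp (c *: b + b'))).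
have sb : fsubset (msupp b) d by rewrite fsubsetUl.
have sb' : fsubset (msupp b') d.
  by rewrite /d fsetUCA fsubsetUl.
have sbb : fsubset (msupp (c *: b + b')) d.
  by rewrite /d fsetUA fsubsetUr.
have sa : fsubset (msupp a) (msupp a) by exact: fsubset_refl.
rewrite (pmulEw sa sb) (pmulEw sa sb') (pmulEw sa sbb).
rewrite scaler_sumr -big_split; apply: eq_bigr => p _ /=.
rewrite scaler_sumr -big_split; apply: eq_bigr => q _ /=.
by rewrite mcoeffD mcoeffZ mulrDr scalerDl scalerA mulrCA.
Qed.

Section Quotient.
Variable rels : set pathalg.

Definition ideal_pred : {pred pathalg} := [pred a | `[< gen_ideal rels a >]].

Lemma gen_ideal_ideal : two_sided_ideal (gen_ideal rels).
Proof.
split; first split.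
- by move=> A [[[]]].
- move=> c u v Su Sv A [AI rA]; have [[_ AZ] _] := AI.
  by apply: AZ; [apply: Su | apply: Sv].
- by move=> a b Sb; split=> A [AI rA]; have [_ /(_ a b)[]] := AI; try exact: Sb.
Qed.

Lemma ideal_pred_zmod_closed : zmod_closed ideal_pred.
Proof.
have [[I0 IZ] _] := gen_ideal_ideal; split; first exact/asboolP.
move=> u v /asboolP Iu /asboolP Iv; apply/asboolP.
by rewrite addrC -scaleN1r; apply: IZ.
Qed.

HB.instance Definition _ :=
  GRing.isZmodClosed.Build pathalg ideal_pred ideal_pred_zmod_closed.

(* The path algebra modulo the two-sided ideal generated by rels.  When V is
   infinite it has no unit: it is then the category algebra (the direct sum of
   all Hom spaces) of the k-linear category presented by the quiver and rels,
   and Hom(x, y) is the subspace (hom x y) below. *)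
Definition qalg : Type := Quotient.quot ideal_pred.
HB.instance Definition _ := GRing.Zmodule.on qalg.
HB.instance Definition _ := EqQuotient.on qalg.

Local Notation cls := (\pi_qalg).

Lemma cls_eqP (a b : pathalg) : cls a = cls b <-> gen_ideal rels (a - b).
Proof.
have E : (cls a == cls b) = (a - b \in ideal_pred).
  by rewrite (@Quotient.idealrBE _ ideal_pred).
split=> [/eqP|ab]; first by rewrite E => /asboolP.
by apply/eqP; rewrite E; apply/asboolP.
Qed.

Lemma gen_ideal_repr (a : pathalg) : gen_ideal rels (a - repr (cls a)).
Proof. by apply/cls_eqP; rewrite reprK. Qed.

Definition qscale (c : k) (a : qalg) : qalg := cls (c *: repr a).

Definition qmul (a b : qalg) : qalg := cls (pmul (repr a) (repr b)).

Lemma cls_scale (c : k) (a : pathalg) : qscale c (cls a) = cls (c *: a).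
Proof.
have [[I0 IZ] _] := gen_ideal_ideal.
apply/esym/cls_eqP; rewrite -scalerBr -[_ *: _]addr0; apply: IZ => //.
exact: gen_ideal_repr.
Qed.

Lemma cls_mul (a b : pathalg) : qmul (cls a) (cls b) = cls (pmul a b).
Proof.
have [[I0 IZ] IM] := gen_ideal_ideal; apply/esym/cls_eqP.
set a' := repr (cls a); set b' := repr (cls b).
have -> : pmul a b - pmul a' b' =
    1 *: pmul (a - a') b + pmul a' (b - b').
  have := pmulDl 1 (a - a') a' b; rewrite !scale1r subrK => ->.
  have := pmulDr 1 a' (b - b') b'; rewrite !scale1r subrK => ->.
  by rewrite addrA addrK.
by apply: IZ; [apply: (IM _ _ _).2 | apply: (IM _ _ _).1];
  apply: gen_ideal_repr.
Qed.

Lemma clsD (a b : pathalg) : cls (a + b) = cls a + cls b.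
Proof.
exact: (@Quotient.pi_add _ ideal_pred). Qed.

Lemma qscaleA (c d : k) (a : qalg) : qscale c (qscale d a) = qscale (c * d) a.
Proof. by rewrite -[a]reprK !cls_scale scalerA reprK. Qed.
Lemma qscale1 : left_id 1 qscale.
Proof. by move=> a; rewrite -[a]reprK cls_scale scale1r. Qed.
Lemma qscaleDr : right_distributive qscale +%R.
Proof.
by move=> c a b; rewrite -[a]reprK -[b]reprK -clsD !cls_scale scalerDr clsD.
Qed.
Lemma qscaleDl (a : qalg) : {morph qscale^~ a : c d / c + d}.
Proof. by move=> c d; rewrite -[a]reprK !cls_scale scalerDl clsD. Qed.

HB.instance Definition _ :=
  GRing.Zmodule_isLmodule.Build k qalg qscaleA qscale1 qscaleDr qscaleDl.

Lemma clsZ (c : k) (a : pathalg) : cls (c *: a) = c *: cls a.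
Proof. by rewrite -cls_scale. Qed.

Definition pclass (p : qpath) : qalg := cls (elt (Some p)).

Definition eclass (x : V) : qalg := cls (idem x).

Definition hom (x y : V) : set qalg :=
  [set qmul (eclass y) (qmul a (eclass x)) | a in setT].

End Quotient.
End QuiverAlgebra.

Arguments idem {k V e} x.
Arguments arrow {k V e} x y.
Arguments eclass {k V e rels} x.
Arguments pclass {k V e rels} p.

Section Preprojective.
Variables (k : closedFieldType) (n : nat).

Definition vertex : Type := {j : nat | (0 < j < n)%N}.
HB.instance Definition _ := Choice.on vertex.
HB.instance Definition _ := SubType.on vertex.

Definition adj : rel vertex :=
  fun u v => (val v == (val u).+1) || (val u == (val v).+1).

(* The arrows alpha_j : j -> j+1 and alpha_j^* : j+1 -> j; they are 0 when j or
   j+1 is not a vertex. *)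
Definition da (j : nat) : pathalg k adj :=
  if (insub j, insub j.+1) is (Some u, Some v) then arrow u v else 0.
Definition da' (j : nat) : pathalg k adj :=
  if (insub j, insub j.+1) is (Some u, Some v) then arrow v u else 0.

Definition preproj_rels : set (pathalg k adj) :=
  [set pmul (da' (val j)) (da (val j)) -
       pmul (da (val j).-1) (da' (val j).-1) | j in [set: vertex]].

Definition preproj : lmodType k := qalg preproj_rels.

Definition nonzero_path (l : nat) (a : preproj) : Prop :=
  a <> 0 /\ exists2 p : qpath adj, size (val p).2 = l & a = pclass p.

Definition simple_ideal (j : vertex) : set preproj :=
  span [set a | (exists l, nonzero_path l a) /\ a <> eclass j].

Definition ideal_mul (I J : set preproj) : set preproj :=
  span [set qmul a b | a in I & b in J].

(* I_{i_1} (I_{i_2} ( ... (I_{i_r} Lambda_n))) for s = [:: i_1; ...; i_r] *)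
Definition word_ideal (s : seq vertex) : set preproj :=
  foldr (fun j I => ideal_mul (simple_ideal j) I) setT s.

Lemma vertex_lt (j : vertex) : (val j < n)%N.
Proof. by case/andP: (valP j). Qed.
Lemma vertex_pred_lt (j : vertex) : ((val j).-1 < n)%N.
Proof. exact: leq_ltn_trans (leq_pred _) (vertex_lt j). Qed.

(* The element a of {1, ..., n} is the ordinal a - 1 : 'I_n, so that
   s_j = (j j+1) exchanges the ordinals j - 1 and j. *)
Definition simple_refl (j : vertex) : 'S_n :=
  tperm (Ordinal (vertex_pred_lt j)) (Ordinal (vertex_lt j)).

(* w = s_{i_1} ... s_{i_r} as a composition of functions: s_{i_r} acts first,
   contrary to the product of the group 'S_n. *)
Definition word_for (w : 'S_n) (s : seq vertex) : Prop :=
  forall a : 'I_n, w a = foldr (fun j => simple_refl j) a s.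

Definition reduced_word (w : 'S_n) (s : seq vertex) : Prop :=
  word_for w s /\ forall s', word_for w s' -> (size s <= size s')%N.

Lemma word_for_tperm (a b : 'I_n) : exists s, word_for (tperm a b) s.
Proof.
wlog ab : a b / (a <= b)%N.
  by move=> W; case/orP: (leq_total a b) => /W // [s]; rewrite tpermC; exists s.
have [m] := ubnP (b - a); elim: m => // m IH in b ab *.
rewrite ltnS leq_eqVlt => /predU1P[bam|]; last exact: IH.
have [E|ab'] := eqVneq a b.
  by exists [::] => c; rewrite E tperm1 perm1.
have lt_ab : (a < b)%N by rewrite ltn_neqAle ab andbT.
have vb : (0 < b < n)%N by rewrite (leq_ltn_trans _ lt_ab) //= ltn_ord.
pose j : vertex := exist _ (b : nat) vb.
pose b' : 'I_n := Ordinal (vertex_pred_lt j).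
have b'E : (b' : nat) = b.-1 by [].
have bE : Ordinal (vertex_lt j) = b by exact: val_inj.
have ab1 : (a <= b')%N by rewrite b'E -ltnS prednK //; have /andP[] := vb.
have [|s sP] := IH b' ab1.
  have /andP[b0 _] := vb.
  by rewrite b'E -bam ltn_sub2rE ?prednK // -ltnS prednK.
have [ab2|ab2] := eqVneq a b'.
  by exists [:: j] => c /=; rewrite /simple_refl bE -/b' -ab2.
exists (j :: rcons s j) => c; rewrite /= -cats1 foldr_cat /= -sP.
rewrite /simple_refl bE -/b'.
set t := tperm b' b.
have -> : t (tperm a b' (t c)) = (tperm a b' ^ t)%g c.
  by rewrite conjgE tpermV !permM.
have ta : t a = a by apply: tpermD; rewrite eq_sym.
by rewrite tpermJ tpermL ta.
Qed.

Lemma reduced_word_exists (w : 'S_n) : exists s, reduced_word w s.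
Proof.
have [s ws] : exists s, word_for w s.
  have [ts -> _] := prod_tpermP w; elim: ts => [|t ts [s sP]].
    by exists [::] => a; rewrite big_nil perm1.
  have [s' s'P] := word_for_tperm t.1 t.2.
  exists (s ++ s') => a; rewrite big_cons permM sP foldr_cat s'P.
  by [].
have P0 : exists m, `[< exists2 s, word_for w s & size s = m >].
  by exists (size s); apply/asboolP; exists s.
case: (ex_minnP P0) => m /asboolP[s0 ws0 <-] mP.
by exists s0; split=> // s' ws'; apply: mP; apply/asboolP; exists s'.
Qed.

Definition summand (I : set preproj) (i : vertex) : set preproj :=
  [set qmul (eclass i) a | a in I].

(* The submodule M of the right module Lambda_n has a composition factor S_j
   given by a path of length l. *)
Definition comp_factor (M : set preproj) (j : vertex) (l : nat) : Prop :=
  exists a, [set qmul b (eclass j) | b in M] a /\ nonzero_path l a.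

End Preprojective.

Arguments word_ideal k {n} s.
Arguments summand {k n} I i.

Section Picture.
Variables (R : realType) (n : nat).

Definition square (j : vertex n) (l : nat) : set (R * R) :=
  [set p | l%:R / n%:R + `|p.1 - (val j)%:R / n%:R| <= p.2
           < l.+2%:R / n%:R - `|p.1 - (val j)%:R / n%:R|].

Definition radical_picture (k : closedFieldType) (M : set (preproj k n)) :
    set (R * R) :=
  \bigcup_(c in [set c : vertex n * nat | comp_factor M c.1 c.2])
    square c.1 c.2.

End Picture.

Arguments radical_picture R {n k} M.

(* No vertex is added for the zero object, whose Hom spaces are all 0. *)
Section Continuous.
Variables (k : closedFieldType) (R : realType).

(* One generator x -> y for every pair (x, y): it is alpha_{yx} when x <= y and
   alpha^*_{yx} when y <= x. *)
Definition total_rel : rel R := fun _ _ => true.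
Definition ca (y x : R) : pathalg k total_rel := arrow x y.
Definition ca' (x y : R) : pathalg k total_rel := arrow y x.

Variant cont_rels : set (pathalg k total_rel) :=
| Cid x : cont_rels (ca x x - idem x)
| Calpha x y z of x <= y & y <= z :
    cont_rels (pmul (ca z y) (ca y x) - ca z x)
| Calpha' x y z of x <= y & y <= z :
    cont_rels (pmul (ca' x y) (ca' y z) - ca' x z)
| Ccomm x a b of 0 < a & 0 < b :
    cont_rels (pmul (ca' (x + a - b) (x + a)) (ca (x + a) x) -
               pmul (ca (x + a - b) (x - b)) (ca' (x - b) x))
(* x becomes a zero object, i.e., its identity vanishes *)
| Czero x of ~~ (0 < x < 1) : cont_rels (idem x).

Definition contalg : lmodType k := qalg cont_rels.

Definition walk_length (p : qpath total_rel) : R :=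
  \sum_(d <- pairmap (fun a b => `|b - a|) (val p).1 (val p).2) d.

Definition path_like (t : R) (f : contalg) : Prop :=
  f <> 0 /\ exists2 p : qpath total_rel, walk_length p = t & f = pclass p.

End Continuous.

Section Permuton.
Variable R : realType.
Local Open Scope ereal_scope.

Local Notation plane := (measurableTypeR R * measurableTypeR R)%type.

Record permuton : Type := Permuton {
  permuton_measure :> {measure set plane -> \bar R};
  permuton_supp : permuton_measure (~` (`[0%R, 1%R] `*` `[0%R, 1%R])) = 0;
  permuton_marginal1 : forall t : R, (0 <= t <= 1)%R ->
    permuton_measure (`[0%R, t] `*` `[0%R, 1%R]) = t%:E;
  permuton_marginal2 : forall t : R, (0 <= t <= 1)%R ->
    permuton_measure (`[0%R, 1%R] `*` `[0%R, t]) = t%:E }.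

Section Gamma.
Variables (n : nat) (w : 'S_n).

(* Ordinals count from 0: this is the square
   [(a-1)/n, a/n] x [(w(a)-1)/n, w(a)/n] for the element a = j + 1. *)
Definition cell (j : 'I_n) : set plane :=
  `[(j%:R / n%:R)%R, (j.+1%:R / n%:R)%R] `*`
  `[((w j)%:R / n%:R)%R, ((w j).+1%:R / n%:R)%R].

Lemma measurable_cell (j : 'I_n) : measurable (cell j).
Proof. by apply: measurableX; exact: measurable_itv. Qed.

(* On each cell, which has area 1/n^2, the uniform measure of weight 1/n has
   density n. *)
Definition gamma_fun (A : set plane) : \bar R :=
  \sum_(j < n) n%:R%:E *
    (lebesgue_measure \x lebesgue_measure) (A `&` cell j).

Let part (j : 'I_n) : {measure set plane -> \bar R} :=
  mscale (n%:R%:nng)%R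
    (mrestr (lebesgue_measure \x lebesgue_measure) (measurable_cell j)).

Let gamma_funE (A : set plane) : gamma_fun A = \sum_(j < n) part j A.
Proof. by []. Qed.

Let gamma0 : gamma_fun set0 = 0.
Proof. by rewrite gamma_funE big1. Qed.

Let gamma_ge0 (A : set plane) : 0 <= gamma_fun A.
Proof. by rewrite gamma_funE sume_ge0. Qed.

Let gamma_sigma : semi_sigma_additive gamma_fun.
Proof.
move=> F mF tF mUF; rewrite gamma_funE.
rewrite [X in _ --> X](_ : _ = \sum_(i <oo) gamma_fun (F i)).
  by apply: is_cvg_ereal_nneg_natsum => i _; exact: gamma_ge0.
rewrite (eq_bigr (fun j => \sum_(i <oo) part j (F i))); last first.
  by move=> j _; rewrite -measure_semi_bigcup.
by rewrite -nneseries_sum.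
Qed.

HB.instance Definition _ :=
  isMeasure.Build _ _ _ gamma_fun gamma0 gamma_ge0 gamma_sigma.

Lemma lebesgue_itv_cap (t a b : R) : (0 <= a)%R -> (a <= b)%R ->
  lebesgue_measure (`[0%R, t] `&` `[a, b] : set (measurableTypeR R)) =
  (Num.min t b - Num.min t a)%:E.
Proof.
move=> a0 ab; have [at_|ta] := leP a t.
  have -> : `[0%R, t] `&` `[a, b] = [set` `[a, Num.min t b]] :> set R.
    apply/seteqP; split=> x /=; rewrite !in_itv /= le_min.
      by move=> [/andP[_ ->] /andP[-> ->]].
    by move=> /and3P[ax -> ->]; rewrite ax (le_trans a0 ax).
  have am : (a <= Num.min t b)%R by rewrite le_min at_.
  rewrite lebesgue_measure_itv /= lte_fin.
  case: ltP => // mb; suff -> : Num.min t b = a by rewrite subrr.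
  by apply/eqP; rewrite eq_le mb am.
have -> : `[0%R, t] `&` `[a, b] = set0 :> set R.
  apply/seteqP; split=> x //=; rewrite !in_itv /=.
  by move=> [/andP[_ xt] /andP[/(lt_le_trans ta)]]; rewrite ltNge xt.
by rewrite measure0 min_l ?subrr // (le_trans _ ab) // ltW.
Qed.

Lemma cell_bounds (m : nat) : (m < n)%N ->
  (0 <= m%:R / n%:R :> R)%R /\ (m%:R / n%:R <= m.+1%:R / n%:R :> R)%R.
Proof.
by move=> mn; split; rewrite ?divr_ge0 ?ler_wpM2r ?invr_ge0 ?ler0n // ler_nat.
Qed.

Lemma gamma_rect (x y : R) : gamma_fun (`[0%R, x] `*` `[0%R, y]) =
  (\sum_(j < n) n%:R *
    ((Num.min x (j.+1%:R / n%:R) - Num.min x (j%:R / n%:R)) *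
     (Num.min y ((w j).+1%:R / n%:R) - Num.min y ((w j)%:R / n%:R))))%R%:E.
Proof.
rewrite -sumEFin; apply: eq_bigr => j _; rewrite !EFinM; congr (_ * _).
have [a0 ab] := cell_bounds (ltn_ord j).
have [c0 cd] := cell_bounds (ltn_ord (w j)).
rewrite /cell -setXI product_measure1E; first last.
- by apply: measurableI; exact: measurable_itv.
- by apply: measurableI; exact: measurable_itv.
by congr (_ * _); exact: lebesgue_itv_cap.
Qed.

Section Marginals.
Hypothesis n_gt0 : (0 < n)%N.

Let nR0 : (n%:R != 0 :> R)%R. Proof. by rewrite pnatr_eq0 -lt0n. Qed.

Lemma sum_min (t : R) : (0 <= t <= 1)%R ->
  (\sum_(j < n) (Num.min t (j.+1%:R / n%:R) - Num.min t (j%:R / n%:R)))%R = t.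
Proof.
move=> /andP[t0 t1].
rewrite -(big_mkord xpredT
  (fun j => Num.min t (j.+1%:R / n%:R) - Num.min t (j%:R / n%:R))%R).
rewrite telescope_sumr // divff // mul0r.
by rewrite (min_l t1) (min_r t0) subr0.
Qed.

Lemma cell_side (m : nat) : (m < n)%N ->
  (n%:R * (Num.min 1 (m.+1%:R / n%:R) - Num.min 1 (m%:R / n%:R)) = 1 :> R)%R.
Proof.
have le1 (l : nat) : (l <= n)%N -> (l%:R / n%:R <= 1 :> R)%R.
  by move=> ln; rewrite ler_pdivrMr ?ltr0n // mul1r ler_nat.
move=> mn; rewrite !min_r ?le1 // ?(ltnW mn) //.
by rewrite -mulrBl -natrB // subSnn mul1r divff.
Qed.

Lemma gamma_supp : gamma_fun (~` (`[0%R, 1%R] `*` `[0%R, 1%R])) = 0.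
Proof.
apply: big1 => j _; rewrite (_ : _ `&` _ = set0) ?measure0 ?mule0 //.
have le1 (l : nat) : (l < n)%N -> (l.+1%:R / n%:R <= 1 :> R)%R.
  by move=> ln; rewrite ler_pdivrMr ?ltr0n // mul1r ler_nat.
have [a0 _] := cell_bounds (ltn_ord j).
have [c0 _] := cell_bounds (ltn_ord (w j)).
apply/seteqP; split=> -[x y] //= [] + [].
rewrite /= !in_itv /= => + /andP[ax xb] /andP[cy yd]; case.
rewrite (le_trans a0 ax) (le_trans c0 cy).
by rewrite (le_trans xb (le1 _ _)) // (le_trans yd (le1 _ _)).
Qed.

Lemma gamma_marginal1 (t : R) : (0 <= t <= 1)%R ->
  gamma_fun (`[0%R, t] `*` `[0%R, 1%R]) = t%:E.
Proof.
move=> t01; rewrite gamma_rect; congr (_%:E); rewrite -[RHS](sum_min t01).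
by apply: eq_bigr => j _; rewrite mulrCA cell_side // mulr1.
Qed.

Lemma gamma_marginal2 (t : R) : (0 <= t <= 1)%R ->
  gamma_fun (`[0%R, 1%R] `*` `[0%R, t]) = t%:E.
Proof.
move=> t01; rewrite gamma_rect; congr (_%:E); rewrite -[RHS](sum_min t01).
rewrite [RHS](reindex_inj (@perm_inj _ w)) /=.
by apply: eq_bigr => j _; rewrite mulrA cell_side // mul1r.
Qed.

Definition gamma : permuton :=
  @Permuton gamma_fun gamma_supp gamma_marginal1 gamma_marginal2.

End Marginals.
End Gamma.
End Permuton.

Section PermutonIdeal.
Variables (k : closedFieldType) (R : realType) (mu : permuton R).

(* f_{mu, y}(x) *)
Definition height (y x : R) : R :=
  - 2 * fine (mu (`[0, x] `*` `[0, y])) + y + x.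

Definition permuton_ideal (y x : R) : set (contalg k R) :=
  span [set f | hom y x f /\ exists2 t, path_like t f & height y x <= t].

Definition permuton_picture (y : R) : set (R * R) :=
  [set p | 0 < p.1 < 1 /\ exists f, permuton_ideal y p.1 f /\ path_like p.2 f].

End PermutonIdeal.

(* Main.v *)
Require Import Defs.
From mathcomp Require Import all_boot all_order all_algebra all_fingroup.
From mathcomp Require Import all_classical all_reals all_analysis.
From mathcomp Require Import -(notations) monalg.
From mathcomp Require Import finmap generic_quotient zify lra ring.

(** Rotate the plane by 45 degrees: describe a path from y to x of length t by
    its apex U = (x + y + t) / 2 and its nadir V = (x + y - t) / 2 (in units of
    1/n).  In the discrete and in the continuous algebra alike, such a path
    equals the ascent from y to U followed by the descent to x, and equally the
    descent to V followed by the ascent to x.  So it vanishes as soon as U or V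
    leaves the open interval of vertices ([qpath_shape] with [up_out] and
    [down_up_out], resp. [pclass_apex] with [eclass_out]).  Conversely, while
    both stay inside, the sum of the coefficients of all paths with these ends
    and this length kills the relations and the ideal they generate
    ([gen_ideal_coef]), so the path is nonzero; the same functional shows that a
    space spanned by paths contains no other nonzero paths than those of the
    types of its spanning set.

    Put mass(X) = n gamma_w([0, X/n] x [0, i/n]).  The continuous picture is
    then the set of all (U, V) with 0 < V <= i <= U < n and
    V <= mass(U + V - i) ([permuton_picture_rot]).

    For the permutation ideal, a nonzero path of length l from j to i lies in
    I_w if and only if i + j <= l + 2 rank, where rank is the number of a <= j
    with w(a) <= i ([comp_factorP]).  This is an induction on a reduced word:
    replacing I_w' by I_m I_w' only matters at the vertex m, where a path must
    now pass through m - 1 or m + 1 on arrival, and the ranks of s_m w' and w'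
    are related accordingly because w' has m before m + 1 ([rank_reflj]).

    Finally, the square of a factor with apex p and nadir q is the set of (U, V)
    with p = floor U and q = ceil V ([square_rot]), and mass takes the value
    rank at the integer j = p + q - i.  As mass is nondecreasing and
    1-Lipschitz, q <= mass(j) is equivalent to V <= mass(U + V - i)
    ([below_corner], [above_corner]). *)

Set Implicit Arguments.
Unset Strict Implicit.
Unset Printing Implicit Defensive.

Import Defs.
Import Order.TTheory GRing.Theory Num.Theory.

Local Open Scope classical_set_scope.
Local Open Scope ring_scope.
Local Open Scope quotient_scope.

(** * Path algebras and sums of coefficients *)

Section PathAlgebra.
Variables (k : fieldType) (V : choiceType) (e : rel V).
Implicit Types (p q r : qpath e) (a b : pathalg k e).

Lemma span_sub (E : lmodType k) (S T : set E) :
  subspace T -> S `<=` T -> span S `<=` T.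
Proof. by move=> Tsub ST f; apply. Qed.

Lemma sub_span (E : lmodType k) (S : set E) : S `<=` span S.
Proof. by move=> f Sf T [_]; apply. Qed.

Lemma mcoeff_U p q (c : k) :
  mcoeff q (mkmalgU p c : pathalg k e) = c * (p == q)%:R.
Proof. by rewrite mulr_natr; apply: mcoeffU. Qed.

Lemma mkmalgUE p (c : k) : mkmalgU p c = c *: elt k (Some p).
Proof.
apply/malgP => q.
transitivity (c * (p == q)%:R); first exact: mcoeff_U.
apply: etrans (esym (mcoeffZ _ _ _)).
by congr (_ * _); rewrite -[LHS]mul1r; apply/esym/mcoeff_U.
Qed.

(** Every element is a combination of paths, so properties of linear type need
    only be checked on paths. *)
Lemma pathalg_ind (S : set (pathalg k e)) :
  subspace S -> (forall p, S (elt k (Some p))) -> forall a, S a.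
Proof.
move=> [S0 SZ] Se a; rewrite [a]monalgE; apply: (big_ind S) => //.
  by move=> u v Su Sv; rewrite -[u]scale1r; apply: SZ.
move=> p _.
rewrite mkmalgUE.
rewrite -[_ *: _]addr0.
exact: SZ.
Qed.

Lemma pmul0l b : pmul 0 b = 0.
Proof.
apply: (addrI (pmul 0 b)); have := pmulDl 1 0 0 b.
by rewrite !scale1r !addr0.
Qed.

Lemma pmul0r a : pmul a 0 = 0.
Proof.
apply: (addrI (pmul a 0)); have := pmulDr 1 a 0 0.
by rewrite !scale1r !addr0.
Qed.

Lemma msupp_elt p : msupp (elt k (Some p)) = fset1 p.
Proof. by rewrite /elt msuppU oner_eq0. Qed.

Lemma msupp_elt_sub p : fsubset (msupp (elt k (Some p))) (fset1 p).
Proof. by rewrite msupp_elt fsubset_refl. Qed.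

Lemma mcoeff_elt p : mcoeff p (elt k (Some p)) = 1.
Proof. by rewrite /elt mcoeffUU. Qed.

Lemma pmul_elt p q : pmul (elt k (Some p)) (elt k (Some q)) = elt k (pcomp p q).
Proof.
rewrite (pmulEw (msupp_elt_sub p) (msupp_elt_sub q)) big_seq_fset1.
by rewrite big_seq_fset1 mcoeff_elt mcoeff_elt mulr1 scale1r.
Qed.

(* Products are from here on computed by bilinearity, from products of paths. *)
#[local] Opaque pmul elt.

Lemma pcomp_none p q : target q != source p -> pcomp p q = None.
Proof. by rewrite /pcomp => /negbTE ->. Qed.

Lemma pcompP p q r : pcomp p q = Some r ->
  [/\ target q = source p, source r = source q, target r = target p &
      val r = ((val q).1, (val q).2 ++ (val p).2)].
Proof.
have [qp|/pcomp_none->//] := eqVneq (target q) (source p).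
have [u -> uE] := pcomp_some qp => -[<-]; split=> //.
  by rewrite /source uE.
by rewrite /target uE /= last_cat -[last (val q).1 _]/(target q) qp.
Qed.

Lemma pcompA p q r : obind (pcomp p) (pcomp q r) =
  obind (fun pq => pcomp pq r) (pcomp p q).
Proof.
have [qr|qr] := eqVneq (target r) (source q); last first.
  rewrite (pcomp_none qr); case pq: (pcomp p q) => [u|] //=.
  by have [_ su _ _] := pcompP pq; rewrite pcomp_none // su.
have [u uP _] := pcomp_some qr; have [_ _ tu uE] := pcompP uP; rewrite uP /=.
have [pq|pq] := eqVneq (target q) (source p); last first.
  by rewrite (pcomp_none pq) pcomp_none // tu.
have [v vP _] := pcomp_some pq; have [_ sv _ vE] := pcompP vP; rewrite vP /=.
rewrite -tu in pq; rewrite -sv in qr.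
have [x -> xE] := pcomp_some pq; have [y -> yE] := pcomp_some qr.
by congr Some; apply: val_inj; rewrite xE yE uE vE /= catA.
Qed.

Lemma pmulA : associative (@pmul k V e).
Proof.
move=> a b c.
have linl (F G : pathalg k e -> pathalg k e) :
    (forall d u v, F (d *: u + v) = d *: F u + F v) ->
    (forall d u v, G (d *: u + v) = d *: G u + G v) ->
    F 0 = 0 -> G 0 = 0 -> subspace [set u | F u = G u].
  move=> FZ GZ F0 G0; split=> [|d u v /= Fu Fv]; first by rewrite /= F0 G0.
  by rewrite FZ GZ Fu Fv.
move: a; apply: pathalg_ind => [|p].
  apply: (linl (fun u => pmul u (pmul b c)) (fun u => pmul (pmul u b) c)).
  - by move=> d u v; rewrite pmulDl.
  - by move=> d u v; rewrite pmulDl pmulDl.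
  - by rewrite pmul0l.
  - by rewrite pmul0l pmul0l.
move: b; apply: pathalg_ind => [|q].
  apply: (linl (fun u => pmul _ (pmul u c)) (fun u => pmul (pmul _ u) c)).
  - by move=> d u v; rewrite pmulDl pmulDr.
  - by move=> d u v; rewrite pmulDr pmulDl.
  - by rewrite pmul0l pmul0r.
  - by rewrite pmul0r pmul0l.
move: c; apply: pathalg_ind => [|r].
  apply: (linl (fun u => pmul _ (pmul _ u)) (fun u => pmul (pmul _ _) u)).
  - move=> d u v.
    exact: etrans (congr1 (pmul _) (pmulDr d _ u v)) (pmulDr d _ _ _).
  - by move=> d u v; exact: pmulDr.
  - exact: etrans (congr1 (pmul _) (pmul0r _)) (pmul0r _).
  - exact: pmul0r.
have E (o o' : option (qpath e)) : pmul (elt k o) (elt k o') =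
    elt k (obind (fun p => obind (pcomp p) o') o).
  case: o => [x|] /=; last by rewrite pmul0l.
  by case: o' => [y|] /=; [rewrite pmul_elt | rewrite pmul0r].
have L : pmul (elt k (Some p)) (pmul (elt k (Some q)) (elt k (Some r))) =
    elt k (obind (pcomp p) (pcomp q r)).
  exact: etrans (congr1 (pmul _) (pmul_elt q r)) (E (Some p) _).
have L' : pmul (pmul (elt k (Some p)) (elt k (Some q))) (elt k (Some r)) =
    elt k (obind (fun pq => pcomp pq r) (pcomp p q)).
  transitivity (pmul (elt k (pcomp p q)) (elt k (Some r))).
    exact: (congr1 (fun u => pmul u (elt k (Some r))) (pmul_elt p q)).
  exact: (E (pcomp p q) (Some r)).
exact: etrans L (etrans (congr1 (@elt k V e) (pcompA p q r)) (esym L')).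
Qed.

Definition triv (x : V) : qpath e :=
  exist (fun p : V * seq V => path e p.1 p.2) (x, [::]) isT.

Lemma idemE (x : V) : idem x = elt k (Some (triv x)).
Proof.
rewrite /idem; case: insubP => [u _ ux|]; last by [].
suff -> : u = triv x by [].
by apply: val_inj; rewrite ux.
Qed.

Lemma pmul_idem_l (x : V) p :
  pmul (idem x) (elt k (Some p)) = if target p == x then elt k (Some p) else 0.
Proof.
rewrite idemE pmul_elt.
case: eqVneq => [px|px]; last by rewrite /pcomp (negbTE px).
have [r -> rE] := @pcomp_some _ _ (triv x) _ px.
suff -> : r = p by [].
by apply: val_inj; rewrite rE /= cats0; apply/esym/surjective_pairing.
Qed.

Lemma pmul_idem_r (x : V) p :
  pmul (elt k (Some p)) (idem x) = if source p == x then elt k (Some p) else 0.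
Proof.
rewrite idemE pmul_elt; case: eqVneq => [px|px]; last first.
  by rewrite /pcomp eq_sym (negbTE px).
have [r -> rE] := @pcomp_some _ _ p (triv x) (esym px).
suff -> : r = p by [].
apply: val_inj; rewrite rE /= -px.
exact/esym/surjective_pairing.
Qed.

Lemma arrowE (x y : V) (exy : e x y) : exists2 p : qpath e,
  val p = (x, [:: y]) & arrow x y = elt k (Some p).
Proof.
rewrite /arrow; case: insubP => [p _ pE|]; first by exists p.
by rewrite /= exy.
Qed.

Lemma path_rcons p (y : V) : e (target p) y -> exists2 r : qpath e,
  val r = ((val p).1, rcons (val p).2 y) &
  elt k (Some r) = pmul (arrow (target p) y) (elt k (Some p)).
Proof.
move=> py; have [q qE ->] := arrowE py.
have [|r rE rV] := @pcomp_some _ _ q p; first by rewrite /source qE.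
by exists r; rewrite ?pmul_elt ?rE // rV qE cats1.
Qed.

(** Induction on the last arrow, which is the leftmost factor of a product. *)
Lemma qpath_ind (P : qpath e -> Prop) :
  (forall x, P (triv x)) ->
  (forall p r y, P p -> e (target p) y ->
     val r = ((val p).1, rcons (val p).2 y) -> P r) ->
  forall p, P p.
Proof.
move=> P0 PS [[x s] xs]; elim/last_ind: s xs => [|s y IH] xs.
  suff -> : exist _ (x, [::]) xs = triv x by apply: P0.
  exact: val_inj.
have := xs; rewrite /= rcons_path => /andP[xs' sy].
exact: (PS (exist (fun p : V * seq V => path e p.1 p.2) (x, s) xs') _ y
  (IH xs') sy).
Qed.

Lemma size0_triv p : size (val p).2 = 0%N -> p = triv (source p).
Proof.
move=> /size0nil p2; apply: val_inj; apply: etrans (surjective_pairing _) _.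
by rewrite p2.
Qed.

Section Coef.
Variable (C : pred (qpath e)).

Definition coef a : k := \sum_(p <- msupp a | C p) mcoeff p a.

Lemma coefEw (d : {fset qpath e}) a : fsubset (msupp a) d ->
  coef a = \sum_(p <- d | C p) mcoeff p a.
Proof.
move=> sa; rewrite /coef big_mkcond [RHS]big_mkcond.
rewrite (big_fset_incl _ sa) //= => p _ /mcoeff_outdom ->.
by case: ifP.
Qed.

Lemma coefD (c : k) a b : coef (c *: a + b) = c * coef a + coef b.
Proof.
pose d := fsetU (msupp a) (fsetU (msupp b) (msupp (c *: a + b))).
have sa : fsubset (msupp a) d by rewrite fsubsetUl.
have sb : fsubset (msupp b) d by rewrite /d fsetUCA fsubsetUl.
have sab : fsubset (msupp (c *: a + b)) d by rewrite /d fsetUA fsubsetUr.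
rewrite (coefEw sa) (coefEw sb) (coefEw sab) mulr_sumr -big_split.
by apply: eq_bigr => p _; rewrite mcoeffD mcoeffZ.
Qed.

Lemma coef0 : coef 0 = 0.
Proof. by rewrite /coef msupp0 big_mkcond big_seq_fset0. Qed.

Lemma coefB a b : coef (a - b) = coef a - coef b.
Proof. by rewrite addrC -scaleN1r coefD mulN1r addrC. Qed.

Lemma coef_elt p : coef (elt k (Some p)) = (C p)%:R.
Proof.
rewrite (coefEw (msupp_elt_sub p)) big_mkcond big_seq_fset1 mcoeff_elt.
by case: (C p).
Qed.

End Coef.

(** Both sides are linear in a, so that a may be assumed to be a path. *)
Lemma coef_ext (C D : pred (qpath e)) (F G : pathalg k e -> pathalg k e) :
  (forall c u v, F (c *: u + v) = c *: F u + F v) ->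
  (forall c u v, G (c *: u + v) = c *: G u + G v) ->
  F 0 = 0 -> G 0 = 0 ->
  (forall p, coef C (F (elt k (Some p))) = coef D (G (elt k (Some p)))) ->
  forall a, coef C (F a) = coef D (G a).
Proof.
move=> FZ GZ F0 G0 FG; apply: pathalg_ind => //.
split; rewrite /= ?F0 ?G0 ?coef0 //.
by move=> c u v /= Eu Ev; rewrite FZ GZ !coefD Eu Ev.
Qed.

End PathAlgebra.
Arguments triv {V e} x.
(** * Path algebras modulo relations *)

Section Quotient.
Variables (k : fieldType) (V : choiceType) (e : rel V).
Variable rels : set (pathalg k e).
Implicit Types (p q r : qpath e) (f g h : qalg rels).

Local Notation cls := (\pi_(qalg rels)).

#[local] Opaque qmul qscale.

Lemma cls0 : cls 0 = 0.
Proof. by apply: (addrI (cls 0)); rewrite -clsD !addr0. Qed.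

Lemma qmulA : associative (@qmul k V e rels).
Proof.
move=> f g h; elim/quotW: f => a; elim/quotW: g => b; elim/quotW: h => c.
apply: etrans (congr1 (qmul _) (cls_mul rels b c)) _.
apply: etrans (cls_mul rels a _) _.
apply/esym.
apply: etrans (congr1 (@qmul _ _ _ _ ^~ _) (cls_mul rels a b)) _.
apply: etrans (cls_mul rels _ c) _.
exact/esym/(congr1 cls (pmulA a b c)).
Qed.

Lemma clsZD (c : k) (a b : pathalg k e) :
  cls (c *: a + b) = c *: cls a + cls b.
Proof. by rewrite -clsZ; apply: clsD. Qed.

Lemma qmulDl (c : k) f g h : qmul (c *: f + g) h = c *: qmul f h + qmul g h.
Proof.
elim/quotW: f => a; elim/quotW: g => b; elim/quotW: h => d.
apply: etrans (congr1 (fun u => qmul u _) (esym (clsZD c a b))) _.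
apply: etrans (cls_mul rels _ d) _.
apply: etrans (congr1 cls (pmulDl c a b d)) _.
apply: etrans (clsZD _ _ _) _.
exact: (congr2 (fun u v => c *: u + v) (esym (cls_mul rels a d))
  (esym (cls_mul rels b d))).
Qed.

Lemma qmulDr (c : k) f g h : qmul f (c *: g + h) = c *: qmul f g + qmul f h.
Proof.
elim/quotW: f => d; elim/quotW: g => a; elim/quotW: h => b.
apply: etrans (congr1 (qmul _) (esym (clsZD c a b))) _.
apply: etrans (cls_mul rels d _) _.
apply: etrans (congr1 cls (pmulDr c d a b)) _.
apply: etrans (clsZD _ _ _) _.
exact: (congr2 (fun u v => c *: u + v) (esym (cls_mul rels d a))
  (esym (cls_mul rels d b))).
Qed.

Lemma qmul0l f : qmul 0 f = 0.
Proof.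
elim/quotW: f => a; rewrite -cls0; apply: etrans (cls_mul rels _ _) _.
exact: (congr1 cls (pmul0l a)).
Qed.

Lemma qmul0r f : qmul f 0 = 0.
Proof.
elim/quotW: f => a; rewrite -cls0; apply: etrans (cls_mul rels _ _) _.
exact: (congr1 cls (pmul0r a)).
Qed.

Lemma eclass_triv (x : V) : eclass x = pclass (triv x) :> qalg rels.
Proof. by rewrite /eclass idemE. Qed.

Lemma eclass_pclass (x : V) p : qmul (eclass x) (pclass p) =
  if target p == x then pclass p else 0 :> qalg rels.
Proof.
rewrite /eclass /pclass cls_mul pmul_idem_l.
by case: ifP => // _; apply: cls0.
Qed.

Lemma pclass_eclass (x : V) p : qmul (pclass p) (eclass x) =
  if source p == x then pclass p else 0 :> qalg rels.
Proof.
rewrite /eclass /pclass cls_mul pmul_idem_r.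
by case: ifP => // _; apply: cls0.
Qed.

Lemma eclass_idem (x : V) : qmul (eclass x) (eclass x) = eclass x :> qalg rels.
Proof. by rewrite {2}eclass_triv eclass_pclass eqxx eclass_triv. Qed.

Definition aclass (x y : V) : qalg rels := cls (arrow x y).

Lemma eclass_aclass (x y : V) : qmul (eclass y) (aclass x y) = aclass x y.
Proof.
have [exy|nexy] := boolP (e x y).
  have [p pE aE] := arrowE k exy.
  by rewrite /aclass aE -[cls _]/(pclass p) eclass_pclass /target pE eqxx.
rewrite /aclass (_ : arrow x y = 0) ?cls0 ?qmul0r //.
by rewrite /arrow insubF //= andbT; apply/negbTE.
Qed.

Lemma aclass_eclass (x y : V) : qmul (aclass x y) (eclass x) = aclass x y.
Proof.
have [exy|nexy] := boolP (e x y).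
  have [p pE aE] := arrowE k exy.
  by rewrite /aclass aE -[cls _]/(pclass p) pclass_eclass /source pE eqxx.
rewrite /aclass (_ : arrow x y = 0) ?cls0 ?qmul0l //.
by rewrite /arrow insubF //= andbT; apply/negbTE.
Qed.

Lemma pclass_rcons p r (y : V) : e (target p) y ->
  val r = ((val p).1, rcons (val p).2 y) ->
  pclass r = qmul (aclass (target p) y) (pclass p) :> qalg rels.
Proof.
move=> py rE; have [r' r'E r'V] := path_rcons k py.
rewrite (_ : r = r') ?/pclass ?r'V ?cls_mul //.
by apply: val_inj; rewrite rE r'E.
Qed.

(** A nonzero path is fixed by the idempotents at its ends and killed by all
    others. *)
Lemma hom_pclass (x y : V) p : hom x y (pclass p : qalg rels) ->
  (pclass p : qalg rels) <> 0 -> source p = x /\ target p = y.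
Proof.
case=> f _ fE p0; split; apply/eqP.
  have : qmul (pclass p) (eclass x) = pclass p :> qalg rels.
    by rewrite -fE -qmulA -qmulA eclass_idem.
  by rewrite pclass_eclass; case: ifP => // _ /esym.
have : qmul (eclass y) (pclass p) = pclass p :> qalg rels.
  rewrite -fE; apply: etrans (qmulA _ _ _) _.
  exact: (congr1 (fun u => qmul u _) (eclass_idem y)).
by rewrite eclass_pclass; case: ifP => // _ /esym.
Qed.

Lemma pclass_hom p : hom (source p) (target p) (pclass p : qalg rels).
Proof.
by exists (pclass p) => //; rewrite pclass_eclass eqxx eclass_pclass eqxx.
Qed.

(** The relations considered here only identify paths with the same ends and the
    same length, up to paths whose apex or nadir leaves the open interval
    (0, N).  This section extracts the consequence common to the discrete and
    the continuous algebra: a path which stays inside is nonzero. *)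
Section Grading.
Variables (R : realDomainType) (N : R) (pos : V -> R) (len : qpath e -> R).
Hypothesis len_comp : forall p q r, pcomp p q = Some r -> len r = len p + len q.
Hypothesis len_ge : forall p, `|pos (target p) - pos (source p)| <= len p.

Definition of_type (x : V) (t : R) (y : V) : pred (qpath e) :=
  fun p => [&& source p == x, len p == t & target p == y].

(** The apex (x + y + t) / 2 lies below N and the nadir (x + y - t) / 2 lies
    above 0. *)
Definition inside (x : V) (t : R) (y : V) : bool :=
  (0 < pos x + pos y - t) && (pos x + pos y + t < N + N).

Hypothesis relsP : forall a x t y, rels a -> inside x t y ->
  coef (of_type x t y) a = 0.

Lemma coef_pred0 (C : pred (qpath e)) (a : pathalg k e) : C =1 pred0 ->
  coef C a = 0.
Proof. by move=> C0; rewrite /coef big_pred0. Qed.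

(** A path r of type (x, t, y) factors as p after q for at most one type of q,
    as p is given. *)
Lemma coef_pmull p x t y (a : pathalg k e) :
  coef (of_type x t y) (pmul (elt k (Some p)) a) =
  if target p == y then coef (of_type x (t - len p) (source p)) a else 0.
Proof.
transitivity (coef (fun q => (target p == y) &&
    of_type x (t - len p) (source p) q) a); last first.
  by case: (target p == y) => //; apply: coef_pred0.
apply: (coef_ext (F := pmul (elt k (Some p))) (G := id)) => //.
- by move=> c u v; apply: pmulDr.
- exact: pmul0r.
move=> q; rewrite pmul_elt coef_elt.
have [qp|qp] := eqVneq (target q) (source p); last first.
  rewrite (pcomp_none qp) /= coef0 /of_type.
  by rewrite [target q == _](negbTE qp) !andbF.
have [r rP _] := pcomp_some qp; have [_ sr tr _] := pcompP rP.
rewrite rP coef_elt /of_type sr tr (len_comp rP) qp eqxx andbT.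
have -> : (len p + len q == t) = (len q == t - len p).
  by rewrite [RHS]eq_sym subr_eq addrC eq_sym.
by case: (target p == y); rewrite ?andbT ?andbF.
Qed.

Lemma coef_pmulr p x t y (a : pathalg k e) :
  coef (of_type x t y) (pmul a (elt k (Some p))) =
  if source p == x then coef (of_type (target p) (t - len p) y) a else 0.
Proof.
transitivity (coef (fun q => (source p == x) &&
    of_type (target p) (t - len p) y q) a); last first.
  by case: (source p == x) => //; apply: coef_pred0.
apply: (coef_ext (F := fun b => pmul b (elt k (Some p))) (G := id)) => //.
- by move=> c u v; apply: pmulDl.
- exact: pmul0l.
move=> q; rewrite pmul_elt coef_elt.
have [pq|pq] := eqVneq (target p) (source q); last first.
  rewrite (pcomp_none pq) /= coef0 /of_type.
  by rewrite [source q == _]eq_sym (negbTE pq) andbF.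
have [r rP _] := pcomp_some pq; have [_ sr tr _] := pcompP rP.
rewrite rP coef_elt /of_type sr tr (len_comp rP) -pq eqxx /=.
have -> // : (len q + len p == t) = (len q == t - len p).
by rewrite [RHS]eq_sym subr_eq eq_sym.
Qed.

(** Cutting off a piece of length len p moves the end by at most len p, hence
    can only lower the apex and raise the nadir. *)
Lemma inside_pre p x t : inside x t (target p) ->
  inside x (t - len p) (source p).
Proof.
have := len_ge p; rewrite /inside ler_norml => /andP[lo hi] /andP[h1 h2].
by apply/andP; split; lra.
Qed.

Lemma inside_suf p t y : inside (source p) t y ->
  inside (target p) (t - len p) y.
Proof.
have := len_ge p; rewrite /inside ler_norml => /andP[lo hi] /andP[h1 h2].
by apply/andP; split; lra.
Qed.

(** The elements with vanishing coefficient sums for all types inside form a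
    two-sided ideal, because types stay inside when a factor is removed. *)
Lemma gen_ideal_coef (a : pathalg k e) x t y :
  gen_ideal rels a -> inside x t y -> coef (of_type x t y) a = 0.
Proof.
pose S := [set b : pathalg k e | forall x t y, inside x t y ->
  coef (of_type x t y) b = 0].
have subS : subspace S.
  split=> [|c u v Su Sv] x' t' y' g; first exact: coef0.
  by rewrite coefD (Su _ _ _ g) (Sv _ _ _ g) mulr0 addr0.
suff SI : two_sided_ideal S.
  move=> Ia; apply: (Ia S); split=> // b rb x' t' y'; exact: relsP.
split=> // u b Sb; split; move: u; apply: pathalg_ind.
- split=> [|c u v Su Sv] x' t' y' g; first by rewrite pmul0l coef0.
  apply: etrans (congr1 (coef _) (pmulDl c u v b)) _.
  apply: etrans (coefD _ c _ _) _.
  have Eu := Su x' t' y' g; have Ev := Sv x' t' y' g.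
  by apply: etrans (congr2 (fun a b => c * a + b) Eu Ev) _; rewrite mulr0 addr0.
- move=> p x' t' y' g; rewrite coef_pmull; case: eqP => // py.
  by apply: Sb; apply: inside_pre; rewrite py.
- split=> [|c u v Su Sv] x' t' y' g; first by rewrite pmul0r coef0.
  apply: etrans (congr1 (coef _) (pmulDr c b u v)) _.
  apply: etrans (coefD _ c _ _) _.
  have Eu := Su x' t' y' g; have Ev := Sv x' t' y' g.
  by apply: etrans (congr2 (fun a b => c * a + b) Eu Ev) _; rewrite mulr0 addr0.
- move=> p x' t' y' g; rewrite coef_pmulr; case: eqP => // px.
  by apply: Sb; apply: inside_suf; rewrite px.
Qed.

(** By [gen_ideal_coef] the choice of representative is immaterial for types
    inside. *)
Definition qcoef (x : V) (t : R) (y : V) (f : qalg rels) : k :=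
  coef (of_type x t y) (repr f).

Lemma qcoef_cls x t y (a : pathalg k e) : inside x t y ->
  qcoef x t y (cls a) = coef (of_type x t y) a.
Proof.
move=> xty.
apply/esym/eqP; rewrite -subr_eq0 -coefB; apply/eqP.
exact: gen_ideal_coef (@gen_ideal_repr _ _ _ rels a) xty.
Qed.

Section Inside.
Variables (x : V) (t : R) (y : V).
Hypothesis xty : inside x t y.

Lemma qcoefD (c : k) f g :
  qcoef x t y (c *: f + g) = c * qcoef x t y f + qcoef x t y g.
Proof.
elim/quotW: f => a; elim/quotW: g => b.
rewrite (qcoef_cls a xty) (qcoef_cls b xty) -coefD -(qcoef_cls _ xty).
exact: (congr1 (qcoef x t y) (esym (clsZD c a b))).
Qed.

Lemma qcoef0 : qcoef x t y 0 = 0.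
Proof. by rewrite -cls0 (qcoef_cls _ xty) coef0. Qed.

Lemma qcoef_pclass p : qcoef x t y (pclass p) = (of_type x t y p)%:R.
Proof. by rewrite (qcoef_cls _ xty) coef_elt. Qed.

Lemma subspace_qcoef : subspace [set f | qcoef x t y f = 0].
Proof.
split=> [|c u v /= Su Sv]; first exact: qcoef0.
by rewrite /= qcoefD Su Sv mulr0 addr0.
Qed.

Lemma qcoef_mull p f : qcoef x t y (qmul (pclass p) f) =
  if target p == y then qcoef x (t - len p) (source p) f else 0.
Proof.
elim/quotW: f => a.
rewrite (_ : qmul _ _ = cls (pmul (elt k (Some p)) a)); last exact: cls_mul.
rewrite (qcoef_cls _ xty) coef_pmull; case: eqP => // py.
have ip : inside x (t - len p) (source p) by apply: inside_pre; rewrite py.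
exact: esym (qcoef_cls _ ip).
Qed.

Lemma qcoef_mulr p f : qcoef x t y (qmul f (pclass p)) =
  if source p == x then qcoef (target p) (t - len p) y f else 0.
Proof.
elim/quotW: f => a.
rewrite (_ : qmul _ _ = cls (pmul a (elt k (Some p)))); last exact: cls_mul.
rewrite (qcoef_cls _ xty) coef_pmulr; case: eqP => // py.
have ip : inside (target p) (t - len p) y by apply: inside_suf; rewrite py.
exact: esym (qcoef_cls _ ip).
Qed.

End Inside.

Lemma len_triv (x : V) : len (triv x) = 0.
Proof.
have [r rP rE] := @pcomp_some V e (triv x) (triv x) erefl.
have E : r = triv x by apply: val_inj.
have := len_comp rP; rewrite E => H.
by apply: (addrI (len (triv x))); rewrite addr0 -H.
Qed.

Lemma qcoef_eclassl x t y f : inside x t y ->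
  qcoef x t y (qmul (eclass y) f) = qcoef x t y f.
Proof.
move=> xty; rewrite eclass_triv qcoef_mull //.
by rewrite -[target _]/y -[source _]/y eqxx len_triv subr0.
Qed.

Lemma qcoef_eclassr x t y f : inside x t y ->
  qcoef x t y (qmul f (eclass x)) = qcoef x t y f.
Proof.
move=> xty; rewrite eclass_triv qcoef_mulr //.
by rewrite -[target _]/x -[source _]/x eqxx len_triv subr0.
Qed.

Lemma qcoef_short x t y f : t < `|pos y - pos x| -> qcoef x t y f = 0.
Proof.
move=> lt_t; apply: coef_pred0 => p.
apply/negbTE/negP => /and3P[/eqP px /eqP pt /eqP py].
by have := len_ge p; rewrite px py pt leNgt lt_t.
Qed.

(** The coefficient sum of the type of p takes the value 1 at p. *)
Lemma inside_neq0 p : inside (source p) (len p) (target p) ->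
  (pclass p : qalg rels) <> 0.
Proof.
move=> ip p0; have := qcoef_pclass ip p; rewrite p0 qcoef0 //.
by rewrite /of_type !eqxx => /eqP; rewrite eq_sym oner_eq0.
Qed.

End Grading.
End Quotient.
Arguments aclass {k V e rels} x y.
(** * Reduced words and ranks *)

Section ReducedWords.
Variable n : nat.
Implicit Types (w : 'S_n) (s : seq (vertex n)) (j : vertex n).

Local Notation lo j := (Ordinal (vertex_pred_lt j)).
Local Notation hi j := (Ordinal (vertex_lt j)).

(** An adjacent transposition reverses the order of one pair only. *)
Lemma simple_refl_lt j (a b : 'I_n) : (a < b)%N ->
  (simple_refl j a < simple_refl j b)%N \/ simple_refl j = tperm a b.
Proof.
move=> ab.
have [/andP[/eqP -> /eqP ->]|nab] := boolP ((a == lo j) && (b == hi j)).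
  by right.
left; move: nab (valP j) ab; rewrite /simple_refl.
by case: tpermP => [->|->|/eqP + /eqP +]; case: tpermP => [->|->|/eqP + /eqP +];
  rewrite -!val_eqE /=; lia.
Qed.

Lemma word_for_cons w j s :
  word_for w (j :: s) -> word_for (w * simple_refl j)%g s.
Proof. by move=> ws a; rewrite permM ws /= tpermK. Qed.

Lemma cons_word_for w j s :
  word_for (w * simple_refl j)%g s -> word_for w (j :: s).
Proof. by move=> ws a; rewrite /= -ws permM tpermK. Qed.

(** Exchange condition: read the word from the left and follow the pair (a, b).
    It ends up reversed, so some letter reverses it, and that letter is then the
    conjugate of tperm a b by the letters before it; deleting this letter
    multiplies w by tperm a b. *)
Lemma exchange s w (a b : 'I_n) : word_for w s ->
  (a < b)%N -> ((w^-1)%g b < (w^-1)%g a)%N ->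
  exists2 s', (size s' < size s)%N & word_for (w * tperm a b)%g s'.
Proof.
elim: s w a b => [|j s IH] w a b ws ab ba.
  have w1 : w = 1%g by apply/permP => c; rewrite ws perm1.
  by move: ba; rewrite w1 invg1 !perm1 ltnNge ltnW.
have w's := word_for_cons ws; set w' := (w * simple_refl j)%g in w's.
have [lt_ab|tE] := simple_refl_lt j ab; last first.
  by exists s => //; rewrite -tE.
have invE c : (w'^-1)%g (simple_refl j c) = (w^-1)%g c.
  by rewrite invMg permM permK.
have [|s' s's ws'] := IH _ _ _ w's lt_ab; first by rewrite !invE.
exists (j :: s') => //; apply: cons_word_for.
suff -> : (w * tperm a b * simple_refl j)%g =
  (w' * tperm (simple_refl j a) (simple_refl j b))%g by [].
by rewrite -tpermJ conjgE !mulgA mulgK.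
Qed.

(** Otherwise the exchange condition would give a shorter word for w. *)
Lemma reduced_word_cons w j s : reduced_word w (j :: s) ->
  let w' := (w * simple_refl j)%g in
  reduced_word w' s /\ ((w'^-1)%g (lo j) < (w'^-1)%g (hi j))%N.
Proof.
move=> [ws minw] w'; have w's := word_for_cons ws; split.
  by split=> // s' /cons_word_for /minw.
rewrite ltnNge leq_eqVlt; apply/negP => /predU1P[|lt_hl].
  by move=> /val_inj /perm_inj /(congr1 val); have /= := valP j; lia.
have lt_lh : (lo j < hi j)%N by have /= := valP j; lia.
have [s' s's] := exchange w's lt_lh lt_hl.
rewrite -[tperm _ _]/(simple_refl j) /w' -mulgA tperm2 mulg1 => /minw /=.
by rewrite leqNgt ltnW // ltnS.
Qed.

Definition rank w (i j : nat) : nat := \sum_(a < n) ((a < j) && (w a < i))%N.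

Lemma rank0 w c : rank w 0 c = 0%N.
Proof. by rewrite /rank big1 // => a _; rewrite ltn0 andbF. Qed.

Lemma rank_succ w (i : 'I_n) c :
  rank w i.+1 c = (rank w i c + ((w^-1)%g i < c))%N.
Proof.
rewrite /rank (bigD1 ((w^-1)%g i)) //= permKV ltnS leqnn andbT.
rewrite [in RHS](bigD1 ((w^-1)%g i)) //= permKV ltnn andbF add0n addnC.
congr (_ + _)%N; apply: eq_bigr => a ai; rewrite ltnS [(w a <= i)%N]leq_eqVlt.
suff /negbTE -> : nat_of_ord (w a) != nat_of_ord i by [].
by apply: contra ai => /eqP/val_inj <-; rewrite permK.
Qed.

Lemma rank_le w i i' c : (i <= i')%N -> (i' <= n)%N ->
  (rank w i c <= rank w i' c <= rank w i c + (i' - i))%N.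
Proof.
move=> ii'; rewrite -(subnKC ii') addKn; elim: (_ - _)%N => [|d IH] lt_n.
  by rewrite !addn0 leqnn.
rewrite addnS in lt_n *; have := IH (ltnW lt_n).
by rewrite (rank_succ w (Ordinal lt_n)) /=; case: (_ < c)%N; lia.
Qed.

Lemma sum_lt_ord c : (c <= n)%N -> (\sum_(a < n) (a < c)%N)%N = c.
Proof.
move=> cn; rewrite -[RHS]card_ord -sum1_card (big_ord_widen n (fun=> 1%N) cn).
by rewrite [RHS]big_mkcond; apply: eq_bigr => a _; case: (a < c)%N.
Qed.

Lemma rank_bound w i c : (i <= n)%N -> (c <= n)%N ->
  (rank w i c <= i)%N /\ (rank w i c <= c)%N.
Proof.
move=> lei lec; split.
  by have := rank_le w c (leq0n i) lei; rewrite rank0; lia.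
rewrite -{2}(sum_lt_ord lec); apply: leq_sum => a _.
by case: (a < c)%N; case: (_ < _)%N.
Qed.

Lemma rank_id w i c : word_for w [::] -> (i <= n)%N -> (c <= n)%N ->
  rank w i c = minn i c.
Proof.
move=> w1 lei lec; rewrite -(@sum_lt_ord (minn i c)) ?geq_min ?lei //.
by apply: eq_bigr => a _; rewrite w1 /= leq_min andbC.
Qed.

Section Step.
Variables (w : 'S_n) (j : vertex n).
Let w' := (w * simple_refl j)%g.

Lemma rank_refl i c : i != val j -> rank w i c = rank w' i c.
Proof.
move=> ij; apply: eq_bigr => a _; congr (nat_of_bool (_ && _)).
move: ij (valP j).
rewrite /w' permM /simple_refl.
by case: tpermP => [->|->|] //=; lia.
Qed.

(** With A, B = 1 or 0 according to whether w' has the value j, resp. j + 1,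
    among its first c places, rank w' grows by A at j and by B at j + 1, while
    rank w grows by B at j.  All three claims follow from B <= A, which is the
    hypothesis.  In terms of lengths: the least length at the vertex j for w is
    one more than the smaller of those at j - 1 and j + 1 for w'. *)
Lemma rank_reflj c : ((w'^-1)%g (lo j) < (w'^-1)%g (hi j))%N ->
  [/\ (rank w' (val j).-1 c <= rank w (val j) c)%N,
      (rank w' (val j).+1 c <= (rank w (val j) c).+1)%N &
      (rank w (val j) c <= rank w' (val j).-1 c)%N \/
      ((rank w (val j) c).+1 <= rank w' (val j).+1 c)%N].
Proof.
have /andP[j0 jn] := valP j.
have jE : val j = (lo j).+1 by rewrite /= prednK.
have wE : (w^-1)%g (lo j) = (w'^-1)%g (hi j).
  by rewrite invMg permM tpermV /simple_refl tpermR.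
have j'j : (val j).-1 != val j by lia.
have R1 := rank_succ w (lo j) c; have R2 := rank_succ w' (lo j) c.
have R3 := rank_succ w' (hi j) c.
have R4 := rank_refl c j'j.
rewrite wE -jE /= in R1; rewrite -jE /= in R2; rewrite /= in R3.
move=> lt_lh; move: R1 R2 R3 R4 lt_lh.
set hi' := (w'^-1)%g (hi j); set lo' := (w'^-1)%g (lo j).
rewrite /=; case: (ltnP hi' c); case: (ltnP lo' c); split; lia.
Qed.

End Step.
End ReducedWords.
(** * Paths in the preprojective algebra *)

Section Discrete.
Variables (k : closedFieldType) (n : nat).
Implicit Types (x y u v j : vertex n) (p q r : qpath (@adj n)).

Local Notation rels := (@preproj_rels k n).
Local Notation Q := (qalg rels).
Local Notation cls := (\pi_(qalg rels)).

(** The generators at all natural numbers, equal to 0 out of range, so that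
    computations need not carry proofs that vertices exist. *)
Definition vtx (i : nat) : Q := if insub i is Some u then eclass u else 0.
Definition alpha (i : nat) : Q := cls (da k n i).
Definition alpha' (i : nat) : Q := cls (da' k n i).

Lemma vtx_val x : vtx (val x) = eclass x.
Proof. by rewrite /vtx valK. Qed.

Variant da_spec (i : nat) : pathalg k (@adj n) -> pathalg k (@adj n) -> Type :=
| DaIn u v of val u = i & val v = i.+1 : da_spec i (arrow u v) (arrow v u)
| DaOut of (i == 0)%N || (n <= i.+1)%N : da_spec i 0 0.

Lemma daP (i : nat) : da_spec i (da k n i) (da' k n i).
Proof.
rewrite /da /da'; case: insubP => [u _ uE|no]; last by apply: DaOut; lia.
case: insubP => [v _ vE|no]; first exact: DaIn.
by apply: DaOut; lia.
Qed.

Lemma alpha_vtx i : qmul (alpha i) (vtx i) = alpha i.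
Proof.
rewrite /alpha; case: daP => [u v <- _|_].
  by rewrite vtx_val aclass_eclass.
by rewrite cls0 qmul0l.
Qed.

Lemma vtx_alpha i : qmul (vtx i.+1) (alpha i) = alpha i.
Proof.
rewrite /alpha; case: daP => [u v _ <-|_].
  by rewrite vtx_val eclass_aclass.
by rewrite cls0 qmul0r.
Qed.

Lemma alpha_out i : (i == 0)%N || (n <= i.+1)%N -> alpha i = 0.
Proof.
rewrite /alpha; case: daP => [u v <- vE io|_ _]; last exact: cls0.
by move: (valP u) (valP v) vE io => /=; lia.
Qed.

Lemma alpha'_out i : (i == 0)%N || (n <= i.+1)%N -> alpha' i = 0.
Proof.
rewrite /alpha'; case: daP => [u v <- vE io|_ _]; last exact: cls0.
by move: (valP u) (valP v) vE io => /=; lia.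
Qed.

(** The relation at the vertex i + 1; past the ends both sides are 0. *)
Lemma mesh i : qmul (alpha i) (alpha' i) = qmul (alpha' i.+1) (alpha i.+1).
Proof.
have [lt_in|le_ni] := ltnP i.+1 n; last first.
  have -> : alpha i = 0 by apply: alpha_out; rewrite le_ni orbT.
  have -> : alpha' i.+1 = 0 by apply: alpha'_out; lia.
  by apply: etrans (qmul0l _) (esym (qmul0l _)).
pose j : vertex n := exist _ i.+1 lt_in.
apply: etrans (cls_mul rels (da k n i) (da' k n i)) _.
apply: etrans _ (esym (cls_mul rels (da' k n i.+1) (da k n i.+1))).
by apply/esym/cls_eqP => S [_]; apply; exists j.
Qed.

(** [down i d] descends by d steps and ends at i; [up i m] ascends by m steps
    from i. *)
Fixpoint down (i d : nat) : Q :=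
  if d is d'.+1 then qmul (alpha' i) (down i.+1 d') else vtx i.
Fixpoint up (i m : nat) : Q :=
  if m is m'.+1 then qmul (alpha (i + m')) (up i m') else vtx i.

(** Moving one ascent to the start of a descent, by d uses of [mesh]. *)
Lemma alpha_down i d :
  qmul (alpha i) (down i d) = qmul (down i.+1 d) (alpha (i + d)).
Proof.
elim: d i => [|d IH] i /=; first by rewrite addn0 vtx_alpha alpha_vtx.
rewrite -qmulA.
apply: etrans (qmulA _ _ _) _.
apply: etrans (congr1 (fun f => qmul f _) (mesh i)) _.
apply: etrans (esym (qmulA _ _ _)) _.
by apply: (congr1 (qmul _)); rewrite IH addSnnS.
Qed.

Lemma up_out i m : (n <= i + m)%N -> up i m = 0.
Proof.
case: m => [|m] le_n /=; last by rewrite alpha_out ?qmul0l //; lia.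
by rewrite /vtx insubF //; lia.
Qed.

(** Each ascent can be moved past the descent, which lowers the end of the
    descent by 1; after i such moves it reaches 0, which is not a vertex. *)
Lemma down_up_out i d c m : (i + d = c + m)%N -> (i <= m)%N ->
  qmul (down i d) (up c m) = 0.
Proof.
elim: m i d => [|m IH] [|i] d // E le_im; first last.
- rewrite /=; apply: etrans (qmulA _ _ _) _.
  have -> : (c + m = i + d)%N by lia.
  apply: etrans (congr1 (fun f => qmul f _) (esym (alpha_down i d))) _.
  apply: etrans (esym (qmulA _ _ _)) _.
  by rewrite IH ?qmul0r //; lia.
all: suff -> : down 0 d = 0 by rewrite qmul0l.
all: case: d E => [|d] _ /=; first by rewrite /vtx insubF.
all: by rewrite alpha'_out ?qmul0l.
Qed.

Lemma aclass_up u v : val v = (val u).+1 -> aclass u v = alpha (val u) :> Q.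
Proof.
move=> E; rewrite /alpha; case: daP => [u' v' /val_inj -> |io].
  by rewrite -E => /val_inj ->.
by move: (valP u) (valP v) E io => /=; lia.
Qed.

Lemma aclass_down u v : val u = (val v).+1 -> aclass u v = alpha' (val v) :> Q.
Proof.
move=> E; rewrite /alpha'; case: daP => [u' v' /val_inj -> |io].
  by rewrite -E => /val_inj ->.
by move: (valP u) (valP v) E io => /=; lia.
Qed.

(** A path equals an ascent followed by a descent: append the arrows one by one,
    and move each ascending one to the start with [alpha_down]. *)
Lemma qpath_shape p : exists d m, [/\
  (val (target p) + d = val (source p) + m)%N,
  (d + m = size (val p).2)%N &
  pclass p = qmul (down (val (target p)) d) (up (val (source p)) m) :> Q].
Proof.
elim/qpath_ind: p => [x|p r y [d [m [E1 E2 E3]]] py rE].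
  exists 0%N, 0%N; split=> //=.
  by rewrite -eclass_triv vtx_val eclass_idem.
have sr : source r = source p by rewrite /source rE.
have tr : target r = y by rewrite /target rE last_rcons.
rewrite (pclass_rcons rels py rE) E3 sr tr rE size_rcons.
case/orP: (py) => /eqP ty.
  exists d, m.+1; split; [by move: E1 ty => /=; lia|by lia|].
  rewrite (aclass_up ty) ty /=; apply: etrans (qmulA _ _ _) _.
  rewrite -E1; apply: etrans (congr1 (fun f => qmul f _) (alpha_down _ d)) _.
  exact: (esym (qmulA _ _ _)).
exists d.+1, m; split; [by move: E1 ty => /=; lia|by lia|].
rewrite (aclass_down ty) /= -ty; exact: qmulA.
Qed.

Lemma nonzero_shape p : (pclass p : Q) <> 0 ->
  exists d m, [/\ (val (target p) + d = val (source p) + m)%N,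
  (d + m = size (val p).2)%N, (val (source p) + m < n)%N &
  (m < val (target p))%N].
Proof.
have [d [m [E1 E2 ->]]] := qpath_shape p => p0; exists d, m; split=> //.
  by rewrite ltnNge; apply/negP => /up_out H; apply: p0; rewrite H qmul0r.
by rewrite ltnNge; apply/negP => H; apply: p0; rewrite down_up_out.
Qed.

Definition dpos (x : vertex n) : int := (val x)%:Z.
Definition dlen (p : qpath (@adj n)) : int := (size (val p).2)%:Z.

Lemma dlen_comp p q r : pcomp p q = Some r -> dlen r = dlen p + dlen q.
Proof.
by case/pcompP => _ _ _; rewrite /dlen => ->; rewrite size_cat PoszD addrC.
Qed.

Lemma dlen_ge p : `|dpos (target p) - dpos (source p)| <= dlen p.
Proof.
have [d [m [E1 E2 _]]] := qpath_shape p.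
by move: E1 E2; rewrite /dpos /dlen /=; lia.
Qed.

Local Notation inside := (inside n%:Z dpos).
Local Notation of_type := (of_type dlen).

(** Both terms of a relation at j are closed paths of length 2 at j, or 0. *)
Lemma coef_turn x t y u v : adj u v ->
  coef (of_type x t y) (pmul (arrow v u) (arrow u v)) =
  [&& u == x, t == 2 & u == y]%:R :> k.
Proof.
move=> uv; have vu : adj v u by rewrite /adj orbC.
have [p pE ->] := arrowE k uv; have [q qE ->] := arrowE k vu.
rewrite pmul_elt.
have [|r rP rE] := @pcomp_some _ _ q p; first by rewrite /source /target pE qE.
rewrite rP coef_elt /of_type /dlen /source /target rE pE qE /=.
by rewrite [t == _]eq_sym.
Qed.

(** The two paths of length 2 at the vertex j cancel; if one of them does not
    exist, then j is 1 or n - 1 and the type (j, 2, j) is not inside. *)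
Lemma preproj_relsP (a : pathalg k (@adj n)) x t y : rels a -> inside x t y ->
  coef (of_type x t y) a = 0.
Proof.
case=> j _ <-; rewrite /inside /dpos => ins; rewrite coefB.
suff H F : F = pmul (da' k n (val j)) (da k n (val j)) \/
    F = pmul (da k n (val j).-1) (da' k n (val j).-1) ->
    coef (of_type x t y) F = [&& j == x, t == 2 & j == y]%:R.
  apply/eqP; rewrite subr_eq0; apply/eqP.
  exact: etrans (H _ (or_introl erefl)) (esym (H _ (or_intror erefl))).
have out : n = (val j).+1 \/ val j = 1%N ->
    [&& j == x, t == 2 & j == y]%:R = 0 :> k.
  move: ins (valP j); case: eqP => // <-; case: eqP => //= ->.
  by case: eqP => // <- /=; lia.
have := valP j => /= jn; case=> ->.
  case: daP => [u v /val_inj -> vE|no].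
    by rewrite coef_turn // /adj vE eqxx.
  by rewrite pmul0l coef0 out //; move: no jn => /=; lia.
case: daP => [u v uE vE|no].
  have vj : v = j by apply: val_inj; rewrite vE; move: jn => /=; lia.
  have vu : adj v u by rewrite /adj vE uE eqxx orbT.
  by rewrite (coef_turn _ _ _ vu) vj.
by rewrite pmul0l coef0 out //; move: no jn => /=; lia.
Qed.

Lemma inside_shape x y d m : (val y + d = val x + m)%N -> (val x + m < n)%N ->
  (m < val y)%N -> inside x (d + m)%N%:Z y.
Proof.
by move=> /= E lt_n lt_y; rewrite /inside /dpos /=; apply/andP; split; lia.
Qed.

End Discrete.
(** * Paths in permutation ideals *)

Section PermutationIdeal.
Variables (k : closedFieldType) (n : nat).
Implicit Types (x y u v j : vertex n) (p q r : qpath (@adj n)).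

Local Notation rels := (@preproj_rels k n).
Local Notation Q := (qalg rels).
Local Notation inside := (inside n%:Z (@dpos n)).
Local Notation of_type := (of_type (@dlen n)).
Local Notation dcoef := (@qcoef k _ _ rels _ (@dlen n)).

Local Notation mkv := (exist (fun i => (0 < i < n)%N) _).

Let rP := @preproj_relsP k n.

Lemma dcoef_pclass x t y p : inside x t y ->
  dcoef x t y (pclass p) = (of_type x t y p)%:R.
Proof.
by move=> ins; apply: (qcoef_pclass (@dlen_comp n) (@dlen_ge k n) rP ins).
Qed.

Lemma dcoef_mull x t y p (f : Q) : inside x t y ->
  dcoef x t y (qmul (pclass p) f) =
  if target p == y then dcoef x (t - dlen p) (source p) f else 0.
Proof.
by move=> ins; apply: (qcoef_mull (@dlen_comp n) (@dlen_ge k n) rP ins).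
Qed.

Lemma subspace_dcoef x t y : inside x t y ->
  subspace [set f | dcoef x t y f = 0].
Proof.
by move=> ins; apply: (subspace_qcoef (@dlen_comp n) (@dlen_ge k n) rP ins).
Qed.

Lemma inside_nonzero p : inside (source p) (dlen p) (target p) ->
  (pclass p : Q) <> 0.
Proof. exact: (inside_neq0 (@dlen_comp n) (@dlen_ge k n) rP). Qed.

(** Lower bound on lengths.  A generator of I_j I_w' is a path p <> e_j times an
    element of I_w'; by induction its coefficient sums vanish for lengths below
    the bound of w' at the source of p plus the length of p.  That this is at
    least the bound of w at y follows from the Lipschitz property [rank_le] if
    y <> j, and from [rank_reflj] if y = j, where p has length at least 1, even
    at least 2 if it is closed. *)
Lemma word_ideal_coef s (w : 'S_n) (f : Q) x t y : reduced_word w s ->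
  word_ideal k s f -> inside x t y ->
  t + (rank w (val y) (val x)).*2%:Z < (val y + val x)%:Z -> dcoef x t y f = 0.
Proof.
elim: s w f x t y => [|j s IH] w f x t y [ws minw].
  move=> _ ins lt_t; apply: (qcoef_short (@dlen_ge k n)).
  have lex := ltnW (vertex_lt x); have ley := ltnW (vertex_lt y).
  move: lt_t; rewrite (rank_id ws) // /dpos minnE /=; lia.
have [w's jw'] := reduced_word_cons (conj ws minw).
set w' := (w * _)%g in w's jw'.
move=> wf ins lt_t.
suff sub : [set qmul a b | a in simple_ideal j & b in word_ideal k s] `<=`
    [set g | dcoef x t y g = 0].
  exact: (span_sub (subspace_dcoef ins) sub wf).
move=> _ [a Ia] [b Ib] <- /=; move: a Ia.
apply: (span_sub (T := [set a | dcoef x t y (qmul a b) = 0])).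
  split=> [|c f1 f2 E1 E2] /=.
    by rewrite qmul0l; have [] := subspace_dcoef ins.
  have [_ SZ] := subspace_dcoef ins.
  apply: etrans (congr1 (dcoef x t y) (qmulDl c f1 f2 b)) _.
  exact: (SZ c (qmul f1 b) (qmul f2 b) E1 E2).
move=> a [[l [a0 [p pl aE]]] aj] /=; rewrite aE dcoef_mull //.
case: eqP => // py.
apply: (IH w' b x (t - dlen p) (source p) w's Ib).
  by apply: (inside_pre (@dlen_ge k n)); rewrite py.
have [d [m [E1 E2 _]]] := qpath_shape k p.
have nt : target p = j -> source p = j -> (0 < d)%N.
  move=> tp sp; rewrite lt0n; apply/eqP => d0; apply: aj.
  have p0 : size (val p).2 = 0%N by move: E1 E2; rewrite tp sp d0 /=; lia.
  have pj := size0_triv p0; rewrite sp in pj.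
  exact: etrans aE (etrans (congr1 pclass pj) (esym (eclass_triv _ j))).
have lex := ltnW (vertex_lt x); have ley := ltnW (vertex_lt y).
have les := ltnW (vertex_lt (source p)).
rewrite /dlen -E2; move: nt E1; rewrite py => nt E1.
have R := @rank_le n w'.
have R1 := R (val y) (val (source p)) (val x).
have R2 := R (val (source p)) (val y) (val x).
have [yj|yj] := eqVneq (val y) (val j); last first.
  have W := rank_refl w (val x) yj.
  by move: lt_t W R1 R2 E1 ley les; rewrite -/w' /=; lia.
have [Q1 Q2 _] := rank_reflj (val x) jw'; rewrite -/w' in Q1 Q2.
have R3 := R (val j).-1 (val (source p)) (val x).
have R4 := R (val (source p)) (val j).-1 (val x).
have R5 := R (val j).+1 (val (source p)) (val x).
have R6 := R (val (source p)) (val j).+1 (val x).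
have jn := vertex_lt j; have jp := vertex_pred_lt j.
have nt' : val (source p) = val j -> (0 < d)%N.
  by move=> /val_inj sj; apply: nt => //; apply: val_inj.
move: lt_t; rewrite yj in E1 *.
move: E1 nt' Q1 Q2 R3 R4 R5 R6 jn jp les => /=; lia.
Qed.

Lemma aclass_pclass u v : adj u v -> exists2 p, val p = (u, [:: v]) &
  aclass u v = pclass p :> Q.
Proof.
move=> uv; have [p pE aE] := arrowE k uv; exists p => //.
exact: (congr1 (\pi_Q) aE).
Qed.

Lemma qpath_rcons p y : adj (target p) y -> exists r,
  [/\ source r = source p, target r = y, size (val r).2 = (size (val p).2).+1 &
  pclass r = qmul (aclass (target p) y) (pclass p) :> Q].
Proof.
move=> py; have [r rE _] := path_rcons k py; exists r.
rewrite /source /target rE size_rcons last_rcons; split=> //.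
exact: pclass_rcons py rE.
Qed.

Lemma qpath_exists x y d m : (val y + d = val x + m)%N -> (val x + m < n)%N ->
  exists p, [/\ source p = x, target p = y & size (val p).2 = (d + m)%N].
Proof.
elim: d y => [|d IH] y.
  elim: m y => [|m IH] y.
    by rewrite !addn0 => /val_inj -> _; exists (triv x).
  rewrite addn0 addnS => E lt_n.
  have vz : (0 < val x + m < n)%N by move: lt_n (valP x) => /=; lia.
  pose z : vertex n := mkv vz.
  have [||p [ps pt pn]] := IH z; [by rewrite addn0|exact: ltnW|].
  have py : adj (target p) y by rewrite pt /adj E eqxx.
  have [r [rs rt rn _]] := qpath_rcons py.
  by exists r; rewrite rs rt rn pn.
rewrite addnS => E lt_n.
have vz : (0 < (val y).+1 < n)%N by move: E lt_n; rewrite /=; lia.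
pose z : vertex n := mkv vz.
have [||p [ps pt pn]] := IH z; [by rewrite /= addSn|exact: lt_n|].
have py : adj (target p) y by rewrite pt /adj /= eqxx orbT.
have [r [rs rt rn _]] := qpath_rcons py.
by exists r; rewrite rs rt rn pn.
Qed.

Lemma simple_ideal_pclass p j : inside (source p) (dlen p) (target p) ->
  p != triv j -> simple_ideal j (pclass p : Q).
Proof.
move=> ins pj; apply: sub_span; split.
  by exists (size (val p).2); split; [exact: inside_nonzero | exists p].
move=> pE; have := dcoef_pclass p ins; rewrite pE eclass_triv dcoef_pclass //.
rewrite /of_type !eqxx /=.
case: and3P => [[/eqP sj /eqP lj _] _|_ /eqP]; last first.
  by rewrite eq_sym oner_eq0.
have p0 : size (val p).2 = 0%N by move: lj; rewrite /dlen /=; lia.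
by case/eqP: pj; rewrite (size0_triv p0) -sj.
Qed.

(** The bound of [word_ideal_coef] is attained.  If y <> j then e_y is in I_j,
    and a path of I_w' to y serves.  If y = j, the last disjunction of
    [rank_reflj] says through which neighbour z of j to arrive: a path of I_w'
    to z is continued by the arrow from z to j, which lies in I_j. *)
Lemma word_ideal_path s (w : 'S_n) x y d m : reduced_word w s ->
  (val y + d = val x + m)%N -> (val x + m < n)%N -> (m < val y)%N ->
  (val y + val x <= d + m + (rank w (val y) (val x)).*2)%N ->
  exists p, [/\ source p = x, target p = y, size (val p).2 = (d + m)%N &
    word_ideal k s (pclass p)].
Proof.
elim: s w y d m => [|j s IH] w y d m [ws minw] E lt_n lt_y le_r.
  have [p [ps pt pn]] := qpath_exists E lt_n.
  by exists p; split.
have [w's jw'] := reduced_word_cons (conj ws minw).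
set w' := (w * _)%g in w's jw'.
have mulP p q : simple_ideal j (pclass q : Q) -> word_ideal k s (pclass p) ->
    word_ideal k (j :: s) (qmul (pclass q) (pclass p)).
  by move=> Jq Ip; apply: sub_span; exists (pclass q) => //; exists (pclass p).
have [yj|yj] := eqVneq (val y) (val j); last first.
  have W := rank_refl w (val x) yj.
  have [|p [ps pt pn Ip]] := IH w' y d m w's E lt_n lt_y; first by rewrite -W.
  exists p; split=> //.
  have -> : pclass p = qmul (pclass (triv y)) (pclass p) :> Q.
    by rewrite -eclass_triv eclass_pclass pt eqxx.
  apply: mulP => //; apply: simple_ideal_pclass.
    by move: (valP y); rewrite /inside /dpos /dlen /source /target /=; lia.
  apply: contra yj => /eqP /(congr1 (@source _ _)) yj.
  exact/eqP/(congr1 val yj).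
have [_ _ Q3] := rank_reflj (val x) jw'; rewrite -/w' in Q3.
(* continue a path of I_w' to the neighbour z of y by the arrow from z to y *)
have viaP z d' m' : adj z y -> (val z + d' = val x + m')%N ->
    (val x + m' < n)%N -> (m' < val z)%N -> (d + m = (d' + m').+1)%N ->
    (val z + val x <= d' + m' + (rank w' (val z) (val x)).*2)%N ->
    exists p, [/\ source p = x, target p = y, size (val p).2 = (d + m)%N &
    word_ideal k (j :: s) (pclass p)].
  move=> zy E' lt_n' lt_y' dm' le_r'.
  have [p [ps pt pn Ip]] := IH w' z d' m' w's E' lt_n' lt_y' le_r'.
  have py : adj (target p) y by rewrite pt.
  have [r [rs rt rn rV]] := qpath_rcons py; exists r; split.
  - by rewrite rs.
  - by [].
  - by rewrite rn pn dm'.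
  rewrite rV; have [q qE ->] := aclass_pclass py; apply: mulP => //.
  apply: simple_ideal_pclass.
    rewrite /inside /dpos /dlen /source /target qE pt /=.
    by move: (valP z) (valP y) zy; rewrite /adj /=; lia.
  by apply/eqP => /(congr1 val); rewrite qE.
have le_n := ltnW (vertex_lt x); have jn := vertex_lt j.
have le_j : ((val j).-1 <= n)%N by lia.
have [R1 _] := rank_bound w' le_j le_n.
have [_ R2] := rank_bound w' jn le_n.
rewrite yj in E lt_y le_r.
case: Q3 => Q3.
- have vz : (0 < (val j).-1 < n)%N by move: E lt_n lt_y le_r R1 Q3 => /=; lia.
  by apply: (viaP (mkv vz) d m.-1); move: vz yj E lt_n lt_y le_r R1 Q3;
    rewrite /adj /=; lia.
have vz : (0 < (val j).+1 < n)%N by move: E lt_n lt_y le_r R2 Q3 => /=; lia.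
by apply: (viaP (mkv vz) d.-1 m); move: vz yj E lt_n lt_y le_r R2 Q3;
  rewrite /adj /=; lia.
Qed.

Lemma comp_factorP s (w : 'S_n) (x y : vertex n) l : reduced_word w s ->
  comp_factor (summand (word_ideal k s) y) x l <->
  exists d m, [/\ l = (d + m)%N, (val y + d = val x + m)%N,
    (val x + m < n)%N, (m < val y)%N &
    (val y + val x <= l + (rank w (val y) (val x)).*2)%N].
Proof.
move=> ws; split=> [|[d [m [-> E lt_n lt_y le_r]]]]; last first.
  have [p [ps pt pn Ip]] := word_ideal_path ws E lt_n lt_y le_r.
  exists (pclass p); split.
    exists (pclass p); last by rewrite pclass_eclass ps eqxx.
    by exists (pclass p) => //; rewrite eclass_pclass pt eqxx.
  split; last by exists p.
  by apply: inside_nonzero; rewrite ps pt /dlen pn; apply: inside_shape.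
case=> a [[_ [c Ic <-] aE] [a0 [p pl ap]]].
rewrite ap in aE a0.
have pxy : hom x y (pclass p : Q).
  by exists c; [|exact: etrans (qmulA _ _ _) aE].
have [ps pt] := hom_pclass pxy a0.
have [d [m [E1 E2 lt_n lt_y]]] := nonzero_shape a0.
rewrite ps pt in E1 lt_n lt_y; rewrite pl in E2.
exists d, m; split=> //.
rewrite leqNgt; apply/negP => lt_r.
have ins := inside_shape E1 lt_n lt_y.
have := dcoef_pclass p ins; rewrite /of_type ps pt !eqxx /dlen pl -E2 eqxx /=.
rewrite -aE.
have -> : dcoef x (d + m)%N%:Z y (qmul (qmul (eclass y) c) (eclass x)) = 0.
  apply: etrans (qcoef_eclassr (@dlen_comp n) (@dlen_ge k n) rP _ ins) _.
  apply: etrans (qcoef_eclassl (@dlen_comp n) (@dlen_ge k n) rP _ ins) _.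
  by apply: (word_ideal_coef ws Ic ins); move: lt_r; rewrite -E2 /=; lia.
by move/eqP; rewrite eq_sym oner_eq0.
Qed.

End PermutationIdeal.
(** * The continuous picture *)

Section ContinuousPicture.
Variables (k : closedFieldType) (R : realType).
Implicit Types (x y z m t : R) (p q r : qpath (@total_rel R)).

Local Notation rels := (@cont_rels k R).
Local Notation Q := (qalg rels).
Local Notation cls := (\pi_(qalg rels)).
Local Notation len := (@walk_length R).

Lemma cls_rels (a b : pathalg k (@total_rel R)) : rels (a - b) -> cls a = cls b.
Proof. by move=> rab; apply/cls_eqP => S [_]; apply. Qed.

Lemma aclass_id x : aclass x x = eclass x :> Q.
Proof. exact: (cls_rels (Cid k x)). Qed.

Lemma aclass_comp x y z : (x <= y <= z) || (z <= y <= x) ->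
  qmul (aclass y z) (aclass x y) = aclass x z :> Q.
Proof.
move=> xyz; apply: etrans (cls_mul rels (arrow y z) (arrow x y)) _.
apply: cls_rels; case/orP: xyz => /andP[le1 le2].
  exact: (@Calpha k R x y z le1 le2).
exact: (@Calpha' k R z y x le1 le2).
Qed.

(** The commutation relation, extended to the degenerate cases where one of the
    steps is trivial: an apex m may be replaced by the nadir x + y - m. *)
Lemma aclass_swap x y m : x <= m -> y <= m ->
  qmul (aclass m y) (aclass x m) =
  qmul (aclass (x + y - m) y) (aclass x (x + y - m)) :> Q.
Proof.
rewrite le_eqVlt => /predU1P[<- yx|xm].
  have -> : x + y - x = y by ring.
  by rewrite (aclass_comp (y := x)) ?(aclass_comp (y := y)) ?lexx ?yx ?orbT.
rewrite le_eqVlt => /predU1P[ym|ym].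
  rewrite -ym in xm *.
  have -> : x + y - y = x by ring.
  by rewrite (aclass_comp (y := y)) ?(aclass_comp (y := x)) ?lexx ?(ltW xm).
apply: etrans (cls_mul rels (arrow m y) (arrow x m)) _.
apply: etrans _ (esym (cls_mul rels (arrow (x + y - m) y)
  (arrow x (x + y - m)))).
apply: cls_rels.
have a0 : 0 < m - x by rewrite subr_gt0.
have b0 : 0 < m - y by rewrite subr_gt0.
have := @Ccomm k R x _ _ a0 b0.
have -> : x + (m - x) = m by ring.
have -> : m - (m - y) = y by ring.
by have -> : x - (m - y) = x + y - m by ring.
Qed.

Lemma eclass_out x : ~~ (0 < x < 1) -> eclass x = 0 :> Q.
Proof.
move=> x01; rewrite -(cls0 rels); apply: cls_rels; rewrite subr0.
exact: Czero.
Qed.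

Lemma walk_length_rcons p r y : val r = ((val p).1, rcons (val p).2 y) ->
  len r = len p + `|y - target p|.
Proof.
by rewrite /len => ->; rewrite /= -cats1 pairmap_cat big_cat /= big_seq1.
Qed.

Lemma walk_length_comp p q r : pcomp p q = Some r -> len r = len p + len q.
Proof.
case/pcompP => qp _ _; rewrite /len => ->; rewrite /= pairmap_cat big_cat /=.
by rewrite -[last (val q).1 _]/(target q) qp addrC.
Qed.

Lemma walk_length_ge p : `|target p - source p| <= len p.
Proof.
elim/qpath_ind: p => [x|p r y IH _ rE].
  by rewrite /target /source /len /= big_nil subrr normr0.
rewrite (walk_length_rcons rE) {1}/target {1}/source rE /= last_rcons.
rewrite -[_.1]/(source p); apply: le_trans (lerD IH (lexx _)).
apply: le_trans (ler_normD _ _); rewrite le_eqVlt; apply/orP; left.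
by apply/eqP; congr `|_|; ring.
Qed.

Definition apex p : R := (source p + target p + len p) / 2.

Lemma apex_ge p : source p <= apex p /\ target p <= apex p.
Proof.
have := walk_length_ge p; rewrite ler_norml /apex => /andP[h1 h2].
by split; lra.
Qed.

(** Induction on the last step: a descent extends the last descent; an ascent
    from the end of a descent is moved to the start by [aclass_swap], where it
    extends the first ascent. *)
Lemma pclass_apex p :
  pclass p =
  qmul (aclass (apex p) (target p)) (aclass (source p) (apex p)) :> Q.
Proof.
elim/qpath_ind: p => [x|p r y IH py rE].
  have -> : apex (triv x) = x.
    by rewrite /apex /source /target /len /= big_nil; lra.
  by rewrite aclass_id eclass_idem eclass_triv.
have [sm tm] := apex_ge p.
have rs : source r = source p by rewrite /source rE.
have rt : target r = y by rewrite /target rE /= last_rcons.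
apply: etrans (pclass_rcons rels py rE) _; rewrite IH rs rt.
have aE : apex r = (source p + y + (len p + `|y - target p|)) / 2.
  by rewrite /apex rs rt (walk_length_rcons rE).
apply: etrans (qmulA _ _ _) _.
have [yt|ty] := leP y (target p).
  have -> : apex r = apex p.
    by rewrite aE ler0_norm ?subr_le0 // /apex; lra.
  have C : (apex p <= target p <= y) || (y <= target p <= apex p).
    by rewrite yt tm orbT.
  exact: (congr1 (fun f => qmul f _) (aclass_comp C)).
have {}aE : apex r = apex p + (y - target p).
  by rewrite aE gtr0_norm ?subr_gt0 // /apex; lra.
have ltm : apex p <= apex r by rewrite aE; lra.
have lty : y <= apex r by rewrite aE; lra.
have tE : target p = apex p + y - apex r by rewrite aE; ring.
rewrite {1 2}tE.
apply: etrans (congr1 (fun f => qmul f _) (esym (aclass_swap ltm lty))) _.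
apply: etrans (esym (qmulA _ _ _)) _.
have C : (source p <= apex p <= apex r) || (apex r <= apex p <= source p).
  by rewrite sm ltm.
exact: (congr1 (qmul _) (aclass_comp C)).
Qed.

Local Notation inside := (inside (1 : R) id).
Local Notation of_type := (of_type len).
Local Notation ccoef := (@qcoef k _ _ rels _ len).

(** A path factors through its apex, and by [aclass_swap] through its nadir; the
    vertices outside (0, 1) are zero objects. *)
Lemma nonzero_inside p : (pclass p : Q) <> 0 ->
  inside (source p) (len p) (target p).
Proof.
have [sm tm] := apex_ge p.
have out m : ~~ (0 < m < 1) -> aclass (source p) m = 0 :> Q.
  by move=> /eclass_out m0; rewrite -eclass_aclass m0 qmul0l.
move=> p0; apply/andP; split; rewrite ltNge; apply/negP => H; apply: p0.
  rewrite pclass_apex aclass_swap // (out (_ - _)) ?qmul0r //.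
  by apply/negP => /andP[]; rewrite /apex; move: H => /=; lra.
rewrite pclass_apex out ?qmul0r //.
by apply/negP => /andP[]; rewrite /apex; move: H => /=; lra.
Qed.

Lemma coef_arrow x0 t0 y0 x y :
  coef (of_type x0 t0 y0) (arrow x y) =
  [&& x == x0, `|y - x| == t0 & y == y0]%:R :> k.
Proof.
have [//|p pE ->] := @arrowE k _ (@total_rel R) x y _; rewrite coef_elt.
by rewrite /of_type /source /target /len pE /= big_seq1.
Qed.

Lemma coef_arrow2 x0 t0 y0 x y z :
  coef (of_type x0 t0 y0) (pmul (arrow y z) (arrow x y)) =
  [&& x == x0, `|y - x| + `|z - y| == t0 & z == y0]%:R :> k.
Proof.
have [//|p pE ->] := @arrowE k _ (@total_rel R) x y _.
have [//|q qE ->] := @arrowE k _ (@total_rel R) y z _.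
rewrite pmul_elt.
have [|r rP rE] := @pcomp_some _ _ q p; first by rewrite /source /target pE qE.
rewrite rP coef_elt /of_type /source /target /len rE pE qE /=.
by rewrite big_cons big_seq1.
Qed.

Lemma coef_idem x0 t0 y0 x :
  coef (of_type x0 t0 y0) (idem x) = [&& x == x0, 0 == t0 & x == y0]%:R :> k.
Proof.
by rewrite idemE coef_elt /of_type /source /target /len /= big_nil.
Qed.

Lemma cont_relsP (a : pathalg k (@total_rel R)) x t y : rels a ->
  inside x t y -> coef (of_type x t y) a = 0.
Proof.
rewrite /inside => ra ins.
have coefB0 (F G : pathalg k (@total_rel R)) :
    coef (of_type x t y) F = coef (of_type x t y) G ->
    coef (of_type x t y) (F - G) = 0.
  by move=> FG; apply: etrans (coefB _ _ _) _; rewrite FG subrr.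
move: ra.
case=> [u|u v z uv vz|u v z uv vz|u c d c0 d0|u u01]; last first.
- rewrite coef_idem; case: and3P => // -[/eqP ux /eqP t0 /eqP uy].
  move: ins => /andP[]; rewrite -ux -uy -t0 /= => h1 h2.
  by case/negP: u01; apply/andP; split; lra.
- apply: coefB0; apply: etrans (coef_arrow2 _ _ _ u (u + c) (u + c - d)) _.
  apply: etrans _ (esym (coef_arrow2 _ _ _ u (u - d) (u + c - d))).
  have -> : `|u + c - u| = c by rewrite addrC addKr gtr0_norm.
  have -> : `|u + c - d - (u + c)| = d by rewrite addrC addKr normrN gtr0_norm.
  have -> : `|u - d - u| = d by rewrite addrC addKr normrN gtr0_norm.
  have -> : u + c - d - (u - d) = c by ring.
  by rewrite (gtr0_norm c0) [d + c]addrC.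
- apply: coefB0; apply: etrans (coef_arrow2 _ _ _ z v u) _.
  apply: etrans _ (esym (coef_arrow _ _ _ z u)).
  rewrite !ler0_norm ?subr_le0 ?(le_trans uv) //.
  by have -> : - (v - z) + - (u - v) = - (u - z) by ring.
- apply: coefB0; apply: etrans (coef_arrow2 _ _ _ u v z) _.
  apply: etrans _ (esym (coef_arrow _ _ _ u z)).
  rewrite !ger0_norm ?subr_ge0 ?(le_trans uv) //.
  by have -> : v - u + (z - v) = z - u by ring.
apply: coefB0; apply: etrans (coef_arrow _ _ _ u u) _.
apply: etrans _ (esym (coef_idem _ _ _ u)).
by rewrite subrr normr0.
Qed.

Lemma ccoef_pclass x t y p : inside x t y ->
  ccoef x t y (pclass p) = (of_type x t y p)%:R.
Proof.
move=> ins.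
exact: (qcoef_pclass walk_length_comp walk_length_ge cont_relsP ins).
Qed.

(** Every type inside whose length is at least the distance of the ends is that
    of the path through its apex.  The lower bound by the height holds because a
    coefficient sum that vanishes on the generators vanishes on the ideal. *)
Lemma permuton_pictureP (mu : permuton R) y x t :
  permuton_picture k mu y (x, t) <->
  [/\ 0 < x < 1, `|x - y| <= t, inside y t x & height mu y x <= t].
Proof.
split=> [[/= x01 [f [If [f0 [p pt fE]]]]]|[x01 xyt ins ht]]; last first.
  pose m := (y + x + t) / 2.
  have e1 : total_rel (target (triv y : qpath (@total_rel R))) m by [].
  have [p pE _] := path_rcons k e1.
  have e2 : total_rel (target p) x by [].
  have [q qE _] := path_rcons k e2.
  have qs : source q = y by rewrite /source qE /= pE.
  have qt : target q = x by rewrite /target qE /= last_rcons.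
  have ql : len q = t.
    rewrite (walk_length_rcons qE) (walk_length_rcons pE).
    rewrite /target pE /= /len /= big_nil add0r.
    move: xyt; rewrite ler_norml => /andP[h1 h2].
    rewrite ger0_norm ?ler0_norm /m; lra.
  have q0 : (pclass q : Q) <> 0.
    apply: (inside_neq0 walk_length_comp walk_length_ge cont_relsP).
    by rewrite qs qt ql.
  split=> //; exists (pclass q); split; last by split=> //; exists q.
  apply: sub_span; split; first by rewrite -qs -qt; apply: pclass_hom.
  by exists t => //; split=> //; exists q.
rewrite fE in f0 If.
have ins := nonzero_inside f0.
pose T := [set g : Q | hom y x g].
have subT : subspace T.
  split=> [|c u v [a _ <-] [b _ <-]].
    by exists 0 => //; rewrite qmul0l qmul0r.
  exists (c *: a + b) => //.
  apply: etrans (congr1 (qmul _) (qmulDl _ _ _ _)) _.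
  exact: qmulDr.
have hp : hom y x (pclass p : Q).
  by apply: (span_sub subT _ If) => g [].
have [ps pT] := hom_pclass hp f0.
rewrite ps pT pt in ins; split=> //.
  by have := walk_length_ge p; rewrite ps pT pt.
rewrite leNgt; apply/negP => lt_t.
have : ccoef y t x (pclass p) = 0.
  have subC := subspace_qcoef walk_length_comp walk_length_ge cont_relsP ins.
  apply: (span_sub subC _ If) => g [hg [t' [g0 [q qt gE]] ht']] /=.
  rewrite gE ccoef_pclass // /of_type qt; case: and3P => // -[_ /eqP tt' _].
  by move: ht'; rewrite tt' leNgt lt_t.
rewrite ccoef_pclass // /of_type ps pT pt !eqxx /= => /eqP.
by rewrite oner_eq0.
Qed.

End ContinuousPicture.
(** * The mass function of the permuton of a permutation *)

Section Geometry.
Variables (R : realType) (n : nat) (w : 'S_n).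
Implicit Types (X Y T x y t : R).

(** The length of the part of [a, a + 1] to the left of X, for X >= 0. *)
Definition clip X (a : nat) : R := Num.min X a.+1%:R - Num.min X a%:R.

Lemma clipE X (a : nat) :
  clip X a = if X <= a%:R then 0 else if X <= a%:R + 1 then X - a%:R else 1.
Proof.
rewrite /clip -natr1.
by case: (leP X a%:R) => h1; case: (leP X (a%:R + 1)) => h2; lra.
Qed.

Lemma clip_nat (c a : nat) : clip c%:R a = (a < c)%:R.
Proof.
rewrite clipE natr1 !ler_nat; case: leqP => //= ac.
by case: leqP => // ca; rewrite -natrB ?(ltnW ac) // (_ : c - a = 1)%N //; lia.
Qed.

Lemma clip_le X Y a : X <= Y -> clip X a <= clip Y a.
Proof.
rewrite !clipE => XY.
by case: (leP X a%:R) => h1; case: (leP X (a%:R + 1)) => h2;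
  case: (leP Y a%:R) => h3; case: (leP Y (a%:R + 1)) => h4; lra.
Qed.

Lemma sum_clip X : 0 <= X <= n%:R -> \sum_(a < n) clip X a = X.
Proof.
move=> /andP[X0 Xn]; rewrite -(big_mkord xpredT (clip X)).
by rewrite telescope_sumr // (min_l Xn) (min_r X0) subr0.
Qed.

(** n times the mass of [0, X/n] x [0, i/n], by [gamma_mass]. *)
Definition mass (i : nat) X : R := \sum_(a < n) (w a < i)%:R * clip X a.

Lemma mass_nat i (c : nat) : mass i c%:R = (rank w i c)%:R.
Proof.
rewrite /mass /rank natr_sum; apply: eq_bigr => a _.
by rewrite clip_nat -natrM mulnb andbC.
Qed.

(** Each summand is nondecreasing in X, and so is each summand of the
    complementary sum X - mass i X. *)
Lemma mass_le i X Y : 0 <= X -> X <= Y -> Y <= n%:R ->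
  mass i X <= mass i Y <= mass i X + (Y - X).
Proof.
move=> X0 XY Yn; apply/andP; split.
  by apply: ler_sum => a _; rewrite ler_wpM2l ?ler0n // clip_le.
have sX : \sum_(a < n) clip X a = X by rewrite sum_clip // X0 (le_trans XY).
have sY : \sum_(a < n) clip Y a = Y by rewrite sum_clip // Yn (le_trans X0).
rewrite -{2}sX -{2}sY -sumrB -big_split /=; apply: ler_sum => a _.
have := clip_le a XY; case: (w a < i)%N => /=; lra.
Qed.

Lemma gamma_mass i X : (0 < n)%N -> (i <= n)%N ->
  gamma_fun w (`[0%R, X / n%:R] `*` `[0%R, i%:R / n%:R]) = (mass i X / n%:R)%:E.
Proof.
move=> n0 lei; rewrite gamma_rect; congr (_%:E).
rewrite /mass mulr_suml; apply: eq_bigr => a _.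
have E (Z : R) (b : nat) : Num.min (Z / n%:R) (b.+1%:R / n%:R) -
    Num.min (Z / n%:R) (b%:R / n%:R) = clip Z b / n%:R.
  by rewrite -!minr_pMl ?invr_ge0 ?ler0n // -mulrBl.
rewrite E E clip_nat; field.
by rewrite pnatr_eq0 -lt0n.
Qed.

Lemma nat_floor X : 0 <= X -> exists p : nat, p%:R <= X < p%:R + 1.
Proof.
by move=> X0; exists (Num.truncn X); rewrite natr1; apply: truncn_itv.
Qed.

Lemma nat_ceil X : 0 < X -> exists q : nat, q%:R - 1 < X <= q%:R.
Proof.
move=> X0; have [p /andP[h1 h2]] := nat_floor (ltW X0).
have [XE|Xp] := eqVneq X p%:R.
  by exists p; rewrite XE lexx andbT; lra.
exists p.+1; rewrite -natr1 addrK (ltW h2) andbT.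
by rewrite lt_neqAle eq_sym Xp.
Qed.

End Geometry.
(** * Pixels *)

Section Pixels.
Variables (R : realType) (n : nat).
Hypothesis n_ge2 : (2 <= n)%N.
Implicit Types (X T x t : R).

Let n_gt0 : (0 < n%:R :> R). Proof. by rewrite ltr0n ltnW. Qed.
Let nV_gt0 : (0 < n%:R^-1 :> R). Proof. by rewrite invr_gt0. Qed.

Lemma norm_le_rel (a b c d : R) :
  (a + `|d| <= b < c - `|d|) <->
  [/\ a + d <= b, a - d <= b, b < c - d & b < c + d].
Proof.
case: (ger0P d) => h; split.
- by move=> /andP[h1 h2]; split; lra.
- by move=> [h1 h2 h3 h4]; apply/andP; split; lra.
- by move=> /andP[h1 h2]; split; lra.
- by move=> [h1 h2 h3 h4]; apply/andP; split; lra.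
Qed.

(** In the coordinates U, V the square with apex p and nadir q is the half-open
    unit square of all points with floor U = p and ceil V = q. *)
Lemma square_rot (j : vertex n) l (i p q : nat) U V :
  (val j + i = p + q)%N -> (l + q = p)%N ->
  @square R n j l ((U + V - i%:R) / n%:R, (U - V) / n%:R) <->
  (p%:R <= U < p%:R + 1) /\ (q%:R - 1 < V <= q%:R).
Proof.
move=> jE lE.
have {}jE : (val j)%:R = p%:R + q%:R - i%:R :> R.
  by rewrite -natrD -jE natrD addrK.
have {}lE : l%:R = p%:R - q%:R :> R by rewrite -lE natrD addrK.
rewrite /square /= -mulrBl normrM (gtr0_norm nV_gt0) -mulrDl -mulrBl.
rewrite ler_pM2r // ltr_pM2r // -[l.+2]addn2 natrD jE lE.
apply: iff_trans (norm_le_rel _ _ _ _) _; split.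
  by move=> [h1 h2 h3 h4]; split; apply/andP; split; lra.
by move=> [/andP[h1 h2] /andP[h3 h4]]; split; lra.
Qed.

Lemma permuton_picture_rot (k : closedFieldType) (w : 'S_n) (i : nat) U V :
  (i <= n)%N ->
  permuton_picture k (gamma R w (ltnW n_ge2)) (i%:R / n%:R)
    ((U + V - i%:R) / n%:R, (U - V) / n%:R) <->
  [/\ 0 < V <= i%:R, i%:R <= U < n%:R & V <= mass w i (U + V - i%:R)].
Proof.
move=> lei; apply: iff_trans (permuton_pictureP _ _ _ _ _) _.
have G := gamma_mass w (U + V - i%:R) (ltnW n_ge2) lei.
rewrite /height [X in fine X](_ : _ = (mass w i (U + V - i%:R) / n%:R)%:E);
  last exact: G.
set M := mass _ _ _.
have -> : (- 2 * fine (M / n%:R)%:E + i%:R / n%:R + (U + V - i%:R) / n%:R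
    <= (U - V) / n%:R) = (V <= M).
  rewrite /= mulrA -!mulrDl ler_pM2r //.
  by apply/idP/idP => h; lra.
have -> : (0 < (U + V - i%:R) / n%:R < 1) = (0 < U + V - i%:R < n%:R).
  by rewrite pmulr_lgt0 // ltr_pdivrMr // mul1r.
have -> : (`|(U + V - i%:R) / n%:R - i%:R / n%:R| <= (U - V) / n%:R) =
    (V <= i%:R <= U).
  rewrite -mulrBl normrM (gtr0_norm nV_gt0) ler_pM2r // ler_norml.
  by apply/andP/andP => -[h1 h2]; split; lra.
have -> : inside (1 : R) id
    (i%:R / n%:R) ((U - V) / n%:R) ((U + V - i%:R) / n%:R) =
    (0 < V) && (U < n%:R).
  rewrite /inside -mulrDl -mulrBl -mulrDl pmulr_lgt0 // ltr_pdivrMr //.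
  rewrite mulrDl mul1r.
  by apply/andP/andP => -[h1 h2]; split; lra.
split=> [[_ /andP[h3 h4] /andP[h5 h6] h7]|].
  by rewrite h3 h4 h5 h6 h7.
case=> /andP[h1 h2] /andP[h3 h4] h5.
by split=> //; apply/andP; split=> //; lra.
Qed.

End Pixels.

Section Corner.
Variables (R : realType) (N : R) (G : R -> R).
Hypothesis G_le : forall X Y, 0 <= X -> X <= Y -> Y <= N ->
  G X <= G Y <= G X + (Y - X).
Variables j q u v : R.
Hypotheses (v_le : 0 <= v <= j) (j_le : j <= N).
Hypotheses (u01 : 0 <= u < 1) (v1 : v < 1) (X_le : j + u - v <= N).

(** Compare with the case u = 0: G drops by at most v from j to j - v, and
    u >= 0 moves the argument to the right. *)
Lemma below_corner : q <= G j -> q - v <= G (j + u - v).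
Proof.
case/andP: v_le u01 => v0 vj /andP[u0 u1] qG.
have Z0 : 0 <= j - v by lra.
have ZX : j - v <= j + u - v by lra.
have Zj : j - v <= j by lra.
have /andP[lo _] := G_le Z0 ZX X_le.
have /andP[_ hi] := G_le Z0 Zj j_le.
lra.
Qed.

(** If j + u - v >= j then G grows by at most u - v < 1 - v from j on; otherwise
    it does not grow, and v < 1. *)
Lemma above_corner : G j <= q - 1 -> G (j + u - v) < q - v.
Proof.
case/andP: v_le u01 => v0 vj /andP[u0 u1] Gq.
have X0 : 0 <= j + u - v by lra.
have j0 : 0 <= j by lra.
have [jX|/ltW Xj] := leP j (j + u - v).
  by have /andP[_ hi] := G_le j0 jX X_le; lra.
by have /andP[lo _] := G_le X0 Xj j_le; move: v1; lra.
Qed.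

End Corner.

Lemma nat_bounds (R : realType) (i p n : nat) (U : R) :
  p%:R <= U < p%:R + 1 -> i%:R <= U < n%:R -> (i <= p < n)%N.
Proof.
rewrite natr1 => /andP[h1 h2] /andP[h3 h4].
rewrite -ltnS -(ltr_nat R) (le_lt_trans h3 h2) /=.
by rewrite -(ltr_nat R) (le_lt_trans h1 h4).
Qed.

(** The numbers p - i of descents and i - q of ascents of the path from
    p + q - i to i with apex p and nadir q. *)
Lemma corner_shape (i p q r n : nat) :
  (i <= p < n)%N -> (0 < q <= i)%N -> (q <= r)%N ->
  [/\ (p - q = p - i + (i - q))%N, (i + (p - i) = p + q - i + (i - q))%N,
      (p + q - i + (i - q) < n)%N, (i - q < i)%N &
      (i + (p + q - i) <= p - q + r.*2)%N].
Proof. by move=> /andP[h1 h2] /andP[h3 h4] h5; split; lia. Qed.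

Theorem theorem8p1 (k : closedFieldType) (R : realType) (n : nat)
    (n_ge2 : (2 <= n)%N) (w : 'S_n) (s : seq (vertex n))
    (s_reduced : reduced_word w s) (i : vertex n) :
  permuton_picture k (gamma R w (ltnW n_ge2)) ((val i)%:R / n%:R) =
  radical_picture R (summand (word_ideal k s) i).
Proof.
have lei := ltnW (vertex_lt i).
have n_neq0 : n%:R != 0 :> R by rewrite pnatr_eq0 -lt0n ltnW.
(* the coordinates U and V of an arbitrary point *)
have rot x t : exists U V : R,
    x = (U + V - (val i)%:R) / n%:R /\ t = (U - V) / n%:R.
  exists (((val i)%:R + x * n%:R + t * n%:R) / 2).
  exists (((val i)%:R + x * n%:R - t * n%:R) / 2).
  by split; field.
apply/seteqP; split=> -[x t]; have [U [V [-> ->]]] := rot x t.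
- case/(permuton_picture_rot _ _ _ _ _ lei) => Vb Ub Vm.
  have [p pU] := @nat_floor R U (le_trans (ler0n _ _) (proj1 (andP Ub))).
  have [q qV] := @nat_ceil R V (proj1 (andP Vb)).
  have ipn := nat_bounds pU Ub.
  have q0i : (0 < q <= val i)%N.
    case/andP: qV Vb => h1 h2 /andP[h3 h4].
    rewrite -(ltr_nat R) (lt_le_trans h3 h2).
    by rewrite -ltnS -(ltr_nat R) -natr1 -ltrBlDr (lt_le_trans h1 h4).
  have vj : (0 < p + q - val i < n)%N by move: ipn q0i; clear; rewrite /=; lia.
  pose j : vertex n := exist (fun a => (0 < a < n)%N) _ vj.
  have jE : (val j + val i = p + q)%N.
    by rewrite /= subnK //; move: ipn; clear; rewrite /=; lia.
  have lE : ((p - q) + q = p)%N.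
    by rewrite subnK //; move: ipn q0i; clear; rewrite /=; lia.
  exists (j, (p - q)%N); last first.
    by apply/(square_rot n_ge2 _ _ jE lE).
  apply/(comp_factorP k j i _ s_reduced).
  exists (p - val i)%N, (val i - q)%N; apply: corner_shape => //.
  rewrite leqNgt; apply/negP; rewrite -(ler_nat R) -natr1 => lt_q.
  have jR : (val j)%:R = p%:R + q%:R - (val i)%:R :> R.
    by rewrite -natrD -jE natrD addrK.
  have j1 : 1 <= (val j)%:R :> R by rewrite ler1n; have /andP[] := vj.
  have jn : (val j)%:R <= n%:R :> R by rewrite ler_nat ltnW ?vertex_lt.
  case/andP: pU Ub qV Vb => p1 p2 /andP[i1 i2] /andP[q1 q2] /andP[V0 Vi].
  have := @above_corner R n%:R _ (@mass_le R n w (val i)) (val j)%:R q%:R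
    (U - p%:R) (q%:R - V).
  rewrite mass_nat (_ : _ + _ - _ = U + V - (val i)%:R); last first.
    by rewrite jR; ring.
  have -> : q%:R - (q%:R - V) = V by ring.
  move=> lt_V; suff : mass w (val i) (U + V - (val i)%:R) < V.
    by rewrite ltNge Vm.
  by apply: lt_V; try (apply/andP; split); lra.
case=> -[j l] /= /(comp_factorP k j i _ s_reduced).
case=> d [m [lE E lt_n lt_m le_r]] sq.
have jE : (val j + val i = val i + d + (val i - m))%N.
  by move: E lt_m; clear; rewrite /=; lia.
have {}lE : (l + (val i - m) = val i + d)%N.
  by move: lE lt_m; clear; rewrite /=; lia.
move: sq => /(square_rot n_ge2 _ _ jE lE) [/andP[p1 p2] /andP[q1 q2]].
have q_ge1 : 1 <= (val i - m)%N%:R :> R by rewrite ler1n subn_gt0.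
have q_lei : (val i - m)%N%:R <= (val i)%:R :> R by rewrite ler_nat leq_subr.
have i_lep : (val i)%:R <= (val i + d)%N%:R :> R by rewrite ler_nat leq_addr.
have p_ltn : (val i + d)%N%:R + 1 <= n%:R :> R by rewrite natr1 ler_nat E.
have q_ler : (val i - m)%N%:R <= mass w (val i) (val j)%:R :> R.
  rewrite mass_nat ler_nat; move: le_r lE E lt_m; clear; rewrite /=; lia.
have jR : (val j)%:R = (val i + d)%N%:R + (val i - m)%N%:R - (val i)%:R :> R.
  by rewrite -natrD -jE natrD addrK.
apply/(permuton_picture_rot _ _ _ _ _ lei); split.
- by apply/andP; split; lra.
- by apply/andP; split; lra.
move: p1 p2 q1 q2 q_ge1 q_lei i_lep p_ltn q_ler jR.
set p : R := (val i + d)%N%:R; set q : R := (val i - m)%N%:R.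
move=> p1 p2 q1 q2 q_ge1 q_lei i_lep p_ltn q_ler jR.
have := @below_corner R n%:R _ (@mass_le R n w (val i)) (val j)%:R q
    (U - p) (q - V).
rewrite (_ : _ + _ - _ = U + V - (val i)%:R); last by rewrite jR; ring.
have -> : q - (q - V) = V by ring.
by apply=> //; try (apply/andP; split); lra.
Qed.
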